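(* Let $\mathcal{C}$ be an abelian category, let $\mathcal{X}\subseteq\mathcal{C}$ be a class of objects, let $(\mathcal{A},\mathcal{B})$ be an $\mathcal{X}$-complete and $\mathcal{X}$-hereditary pair of classes in $\mathcal{C}$ such that $\mathcal{A}$, $\mathcal{X}$ and $\mathcal{B}$ are closed under extensions and direct summands, and let $\omega:=\mathcal{A}\cap\mathcal{B}\cap\mathcal{X}$. Then the following statements hold true. (a) The class $\omega$ is an $\mathcal{A}\cap\mathcal{X}$-injective relative cogenerator in $\mathcal{A}\cap\mathcal{X}$. (b) The class $\omega$ is a $\mathcal{B}\cap\mathcal{X}$-projective relative generator in $\mathcal{B}\cap\mathcal{X}$. (c) For any $M\in(\mathcal{A},\mathcal{X})^{\wedge}$, we have the equalities $$\mathrm{pd}_{\mathcal{B}\cap\mathcal{X}}(M)=\mathrm{pd}_{\omega}(M)=\mathrm{pd}_{\omega^{\wedge}}(M)=\mathrm{resdim}_{\mathcal{A}}^{\mathcal{X}}(M)=\mathrm{resdim}_{\mathcal{X}\cap\mathcal{A}}(M).$$ (d) $\mathrm{pd}_{\mathcal{B}\cap\mathcal{X}}(M)=\mathrm{resdim}_{\omega}^{\mathcal{X}}(M)$ for all $M\in(\omega,\mathcal{X})^{\wedge}$. (e) For any $M\in(\mathcal{X},\mathcal{B})^{\vee}$, we have the equalities $$\mathrm{id}_{\mathcal{A}\cap\mathcal{X}}(M)=\mathrm{id}_{\omega}(M)=\mathrm{id}_{\omega^{\vee}}(M)=\mathrm{coresdim}_{\mathcal{B}}^{\mathcal{X}}(M)=\mathrm{coresdim}_{\mathcal{X}\cap\mathcal{B}}(M).$$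 (f) $\mathrm{id}_{\mathcal{A}\cap\mathcal{X}}(M)=\mathrm{coresdim}_{\omega}^{\mathcal{X}}(M)$ for all $M\in(\mathcal{X},\omega)^{\vee}$.
   Context: $\mathrm{Ext}$ is Yoneda Ext. For a class $\mathcal{Z}$ and object $C$: $\mathrm{pd}_{\mathcal{Z}}(C):=\min\{n\in\mathbb{N} : \mathrm{Ext}^k_{\mathcal{C}}(C,Z)=0\ \forall Z\in\mathcal{Z},\ \forall k>n\}$ and $\mathrm{id}_{\mathcal{Z}}(C):=\min\{n\in\mathbb{N} : \mathrm{Ext}^k_{\mathcal{C}}(Z,C)=0\ \forall Z\in\mathcal{Z},\ \forall k>n\}$ ($0\in\mathbb N$; $\infty$ if no such $n$); for a class $\mathcal{D}$, $\mathrm{pd}_{\mathcal{Z}}(\mathcal{D})$ and $\mathrm{id}_{\mathcal{Z}}(\mathcal{D})$ are the suprema over objects of $\mathcal{D}$. A class $\omega$ is $\mathcal{Z}$-injective if $\mathrm{id}_{\mathcal{Z}}(\omega)=0$, and $\mathcal{Z}$-projective if $\mathrm{pd}_{\mathcal{Z}}(\omega)=0$. $\omega$ is a relative cogenerator (resp. generator) in $\mathcal{Z}$ if $\omega\subseteq\mathcal{Z}$ and each $Z\in\mathcal{Z}$ admits an exact sequence $0\to Z\to W\to Z'\to0$ (resp. $0\to Z'\to W\to Z\to0$) with $W\in\omega$, $Z'\in\mathcal{Z}$. The pair $(\mathcal{A},\mathcal{B})$ is $\mathcal{X}$-hereditary if $\mathrm{id}_{\mathcal{A}\cap\mathcal{X}}(\mathcal{B}\cap\mathcal{X})=0$.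 It is left $\mathcal{X}$-complete if any $X\in\mathcal{X}$ admits an exact sequence $0\to B\to A\to X\to0$ with $A\in\mathcal{A}\cap\mathcal{X}$, $B\in\mathcal{B}\cap\mathcal{X}$; right $\mathcal{X}$-complete if any $X\in\mathcal{X}$ admits an exact sequence $0\to X\to B\to A\to0$ with $B\in\mathcal{B}\cap\mathcal{X}$, $A\in\mathcal{A}\cap\mathcal{X}$; and $\mathcal{X}$-complete if it is both. For classes $\mathcal{P},\mathcal{Q}\subseteq\mathcal{C}$ and $M\in\mathcal{C}$: a $\mathcal{Q}_{\mathcal{P}}$-coresolution of length $n$ of $M$ is an exact sequence $0\to M\xrightarrow{f_0}Q_0\xrightarrow{f_1}Q_1\to\cdots\xrightarrow{f_n}Q_n\to0$ with $Q_n\in\mathcal{P}\cap\mathcal{Q}$, $Q_k\in\mathcal{Q}$ for $0\le k\le n-1$, and $\mathrm{Im}(f_i)\in\mathcal{P}$ for $1\le i\le n-1$. Dually, a $\mathcal{Q}_{\mathcal{P}}$-resolution of length $n$ of $M$ is an exact sequence $0\to Q_n\xrightarrow{f_n}\cdots\to Q_1\xrightarrow{f_1}Q_0\xrightarrow{f_0}M\to0$ with $Q_n\in\mathcal{P}\cap\mathcal{Q}$, $Q_k\in\mathcal{Q}$ for $0\le k\le n-1$, and $\mathrm{Im}(f_i)\in\mathcal{P}$ for $1\le i\le n-1$. $\mathrm{coresdim}_{\mathcal{Q}}^{\mathcal{P}}(M)$ (resp. $\mathrm{resdim}_{\mathcal{Q}}^{\mathcal{P}}(M)$) is the smallest such $n\ge0$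 ($\infty$ if none). $\mathcal{Q}_{\mathcal{P}}^{\vee}$ (resp. $\mathcal{Q}_{\mathcal{P}}^{\wedge}$) is the class of objects having a $\mathcal{Q}_{\mathcal{P}}$-coresolution (resp. $\mathcal{Q}_{\mathcal{P}}$-resolution) of some finite length. $(\mathcal{P},\mathcal{Q})^{\vee}:=\mathcal{P}\cap\mathcal{Q}_{\mathcal{P}}^{\vee}$ and $(\mathcal{Q},\mathcal{P})^{\wedge}:=\mathcal{Q}_{\mathcal{P}}^{\wedge}\cap\mathcal{P}$. When $\mathcal{P}=\mathcal{C}$ the symbol $\mathcal{P}$ is omitted (giving $\mathcal{Q}^{\vee}$, $\mathcal{Q}^{\wedge}$, $\mathrm{coresdim}_{\mathcal{Q}}$, $\mathrm{resdim}_{\mathcal{Q}}$). *)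

(* Defs.v *)
From Stdlib Require Import Relations.
From mathcomp Require Import all_boot all_algebra.
From mathcomp Require Import boolp classical_sets.

Set Implicit Arguments.
Unset Strict Implicit.
Unset Printing Implicit Defensive.

Import GRing.Theory.

Local Open Scope classical_set_scope.
Local Open Scope ring_scope.

Record preadditiveCategory := PreadditiveCategory {
  Ob :> Type;
  hom : Ob -> Ob -> zmodType;
  idm : forall X, hom X X;
  compm : forall X Y Z, hom Y Z -> hom X Y -> hom X Z;
  comp1m : forall X Y (f : hom X Y), compm (idm Y) f = f;
  compm1 : forall X Y (f : hom X Y), compm f (idm X) = f;
  compmA : forall W X Y Z (h : hom Y Z) (g : hom X Y) (f : hom W X),
    compm h (compm g f) = compm (compm h g) f;
  compmDl : forall X Y Z (g g' : hom Y Z) (f : hom X Y),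
    compm (g + g') f = compm g f + compm g' f;
  compmDr : forall X Y Z (g : hom Y Z) (f f' : hom X Y),
    compm g (f + f') = compm g f + compm g f' }.

Arguments hom {p} X Y.
Arguments idm {p} X.
Arguments compm {p X Y Z} g f.

Declare Scope cat_scope.
Local Open Scope cat_scope.
Notation "g ∘ f" := (compm g f) (at level 40, left associativity) : cat_scope.

Section Preadditive.
Variable C : preadditiveCategory.
Implicit Types X Y Z : C.

Definition mono X Y (m : hom X Y) : Prop :=
  forall T (s t : hom T X), m ∘ s = m ∘ t -> s = t.

Definition epi X Y (e : hom X Y) : Prop :=
  forall T (s t : hom Y T), s ∘ e = t ∘ e -> s = t.

Definition is_kernel K X Y (g : hom X Y) (m : hom K X) : Prop :=
  g ∘ m = 0 /\
  forall T (t : hom T X), g ∘ t = 0 -> exists! s : hom T K, m ∘ s = t.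

Definition is_cokernel X Y Q (f : hom X Y) (e : hom Y Q) : Prop :=
  e ∘ f = 0 /\
  forall T (t : hom Y T), t ∘ f = 0 -> exists! s : hom Q T, s ∘ e = t.

Definition is_zero_object Z : Prop :=
  forall X, (exists! f : hom X Z, True) /\ (exists! f : hom Z X, True).

Definition is_biproduct X Y S : Prop :=
  exists (i1 : hom X S) (i2 : hom Y S) (p1 : hom S X) (p2 : hom S Y),
    [/\ p1 ∘ i1 = idm X, p2 ∘ i2 = idm Y, p1 ∘ i2 = 0, p2 ∘ i1 = 0
      & i1 ∘ p1 + i2 ∘ p2 = idm S].

End Preadditive.

Record abelianCategory := AbelianCategory {
  preadditive_of_abelian :> preadditiveCategory;
  zero_object_ex : exists Z : preadditive_of_abelian, is_zero_object Z;
  biproduct_ex : forall X Y : preadditive_of_abelian,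
    exists S, is_biproduct X Y S;
  kernel_ex : forall (X Y : preadditive_of_abelian) (f : hom X Y),
    exists K (m : hom K X), is_kernel f m;
  cokernel_ex : forall (X Y : preadditive_of_abelian) (f : hom X Y),
    exists Q (e : hom Y Q), is_cokernel f e;
  mono_normal : forall (X Y : preadditive_of_abelian) (m : hom X Y),
    mono m -> exists Z (g : hom Y Z), is_kernel g m;
  epi_normal : forall (X Y : preadditive_of_abelian) (e : hom X Y),
    epi e -> exists Z (f : hom Z X), is_cokernel f e }.

(* The values of homological dimensions: [Some n] is n, [None] is infinity. *)
Definition enat := option nat.

(* The least natural number satisfying P, infinity if there is none. *)
Definition emin (P : nat -> Prop) : enat :=
  match pselect (exists n, `[< P n >]) with
  | left ex => Some (ex_minn ex)
  | right _ => None
  end.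

Definition enat_le_nat (x : enat) (n : nat) : Prop :=
  if x is Some m then (m <= n)%N else False.

(* The least upper bound; the supremum of the empty set is 0. *)
Definition esup (S : set enat) : enat :=
  emin (fun n => forall x, S x -> enat_le_nat x n).

Section Abelian.
Variable C : abelianCategory.
Implicit Types X Y Z M : C.
Implicit Types P Q D A B W : set C.

(* m : I -> Y is the inclusion of the image of f. *)
Definition is_image X Y I (f : hom X Y) (m : hom I Y) : Prop :=
  mono m /\ exists2 e : hom X I, epi e & f = m ∘ e.

Definition exact_at X Y Z (f : hom X Y) (g : hom Y Z) : Prop :=
  exists I (m : hom I Y), is_image f m /\ is_kernel g m.

Definition short_exact X Y Z (f : hom X Y) (g : hom Y Z) : Prop :=
  [/\ mono f, exact_at f g & epi g].

(* chain n X Y : sequences X -> E_1 -> ... -> E_n -> Y of n.+1 composable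
   morphisms, with n intermediate objects. *)
Fixpoint chain (n : nat) (X Y : C) : Type :=
  if n is n'.+1 then {E : C & (hom X E * chain n' E Y)%type} else hom X Y.

(* Exactness of T --f--> X -> E_1 -> ... -> E_n -> Y -> 0 at X, the E_i and Y. *)
Fixpoint exact_after n T X Y (f : hom T X) : chain n X Y -> Prop :=
  match n return chain n X Y -> Prop with
  | 0 => fun g => exact_at f g /\ epi g
  | n'.+1 => fun c => let: existT E (g, c') := c in
                      exact_at f g /\ exact_after g c'
  end.

(* Exactness of 0 -> X -> E_1 -> ... -> E_n -> Y -> 0. *)
Definition exact_chain n X Y : chain n X Y -> Prop :=
  match n return chain n X Y -> Prop with
  | 0 => fun g => mono g /\ epi g
  | n'.+1 => fun c => let: existT E (g, c') := c in
                      mono g /\ exact_after g c'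
  end.

(* There is a commutative ladder from c to c' whose outer vertical morphisms
   are u and v. *)
Fixpoint ladder n X Y X' Y' (u : hom X X') (v : hom Y Y') :
    chain n X Y -> chain n X' Y' -> Prop :=
  match n return chain n X Y -> chain n X' Y' -> Prop with
  | 0 => fun g g' => v ∘ g = g' ∘ u
  | n'.+1 => fun c c' =>
      let: existT E (g, d) := c in
      let: existT E' (g', d') := c' in
      exists w : hom E E', w ∘ g = g' ∘ u /\ ladder w v d d'
  end.

(* Exact sequences 0 -> Z -> E_1 -> ... -> E_k -> Y -> 0. *)
Definition extension (k : nat) Y Z : Type := {c : chain k Z Y | exact_chain c}.

Definition extension_morphism k Y Z (c d : extension k Y Z) : Prop :=
  ladder (idm Z) (idm Y) (sval c) (sval d).

Definition yoneda_equiv k Y Z : relation (extension k Y Z) :=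
  clos_refl_sym_trans _ (@extension_morphism k Y Z).

(* The underlying set of the Yoneda group Ext^k(Y, Z), for k >= 1 (the value at
   k = 0 is not Hom(Y, Z), and is never used). *)
Definition Ext (k : nat) Y Z : set (set (extension k Y Z)) :=
  [set [set d | yoneda_equiv c d] | c in [set: extension k Y Z]].

Arguments Ext k Y Z : clear implicits.

(* Being a group, Ext^k(Y, Z) is 0 exactly when it has at most one element. *)
Definition Ext_eq0 (k : nat) Y Z : Prop := is_subset1 (Ext k Y Z).

Definition pdim D Y : enat :=
  emin (fun n => forall Z, D Z -> forall k, (n < k)%N -> Ext_eq0 k Y Z).

Definition idim D Y : enat :=
  emin (fun n => forall Z, D Z -> forall k, (n < k)%N -> Ext_eq0 k Z Y).

Definition pd_class D D' : enat := esup (pdim D @` D').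

Definition id_class D D' : enat := esup (idim D @` D').

Definition rel_injective D W : Prop := id_class D W = Some 0%N.

Definition rel_projective D W : Prop := pd_class D W = Some 0%N.

Definition rel_cogenerator W D : Prop :=
  W `<=` D /\
  forall Z, D Z -> exists E Z' (f : hom Z E) (g : hom E Z'),
    [/\ short_exact f g, W E & D Z'].

Definition rel_generator W D : Prop :=
  W `<=` D /\
  forall Z, D Z -> exists E Z' (f : hom Z' E) (g : hom E Z),
    [/\ short_exact f g, W E & D Z'].

Definition hereditary_pair D A B : Prop :=
  id_class (A `&` D) (B `&` D) = Some 0%N.

Definition left_complete_pair D A B : Prop :=
  forall X, D X -> exists E F (f : hom F E) (g : hom E X),
    [/\ short_exact f g, (A `&` D) E & (B `&` D) F].

Definition right_complete_pair D A B : Prop :=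
  forall X, D X -> exists E F (f : hom X F) (g : hom F E),
    [/\ short_exact f g, (B `&` D) F & (A `&` D) E].

Definition complete_pair D A B : Prop :=
  left_complete_pair D A B /\ right_complete_pair D A B.

Definition extension_closed D : Prop :=
  forall X Y Z (f : hom X Y) (g : hom Y Z),
    short_exact f g -> D X -> D Z -> D Y.

Definition summand_closed D : Prop :=
  forall X Y S, is_biproduct X Y S -> D S -> D X.

Fixpoint middle_in Q n X Y : chain n X Y -> Prop :=
  match n return chain n X Y -> Prop with
  | 0 => fun=> True
  | n'.+1 => fun c => let: existT E (g, c') := c in Q E /\ middle_in Q c'
  end.

Definition image_in P X Y (f : hom X Y) : Prop :=
  exists I (m : hom I Y), is_image f m /\ P I.

(* The images of all the morphisms of the chain but the last one are in P. *)
Fixpoint images_but_last_in P n X Y : chain n X Y -> Prop :=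
  match n return chain n X Y -> Prop with
  | 0 => fun=> True
  | n'.+1 => fun c => let: existT E (g, c') := c in
                      image_in P g /\ images_but_last_in P c'
  end.

(* The images of all the morphisms of the chain but the first and the last
   ones are in P. *)
Definition inner_images_in P n X Y : chain n X Y -> Prop :=
  match n return chain n X Y -> Prop with
  | 0 => fun=> True
  | n'.+1 => fun c => let: existT E (g, c') := c in images_but_last_in P c'
  end.

(* M has a Q_P-coresolution 0 -> M -> Q_0 -> ... -> Q_n -> 0 of length n, where
   L is Q_n and Q_0, ..., Q_(n-1) are the intermediate objects of the chain. *)
Definition has_coresolution Q P (n : nat) M : Prop :=
  exists L (c : chain n M L),
    [/\ exact_chain c, (P `&` Q) L, middle_in Q c & inner_images_in P c].

(* M has a Q_P-resolution 0 -> Q_n -> ... -> Q_0 -> M -> 0 of length n, where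
   L is Q_n and Q_(n-1), ..., Q_0 are the intermediate objects of the chain. *)
Definition has_resolution Q P (n : nat) M : Prop :=
  exists L (c : chain n L M),
    [/\ exact_chain c, (P `&` Q) L, middle_in Q c & inner_images_in P c].

Definition coresdim Q P M : enat := emin (fun n => has_coresolution Q P n M).

Definition resdim Q P M : enat := emin (fun n => has_resolution Q P n M).

(* Q_P^vee and Q_P^wedge; the non-relative Q^vee, Q^wedge, coresdim and resdim
   are obtained for P = setT. *)
Definition vee Q P : set C := [set M | exists n, has_coresolution Q P n M].

Definition wedge Q P : set C := [set M | exists n, has_resolution Q P n M].

(* (P, Q)^vee and (Q, P)^wedge *)
Definition pair_vee P Q : set C := P `&` vee Q P.

Definition pair_wedge Q P : set C := wedge Q P `&` P.

End Abelian.

Arguments Ext {C} k Y Z _ : rename.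

(* Main.v *)
Require Import Defs.
From Stdlib Require Import Relations.
From mathcomp Require Import all_boot all_algebra.
From mathcomp Require Import boolp classical_sets.
(* [vector] also has a constant [hom]. *)
Import Defs.

(** For M in X, dimension shifting along left X-approximations
   0 -> B0 -> A0 -> M -> 0 shows that Ext^k(M, B ∩ X) = 0 for all k > n if and
   only if the n-th syzygy built in this way is a direct summand of an object
   of A, i.e. M has an A_X-resolution of length n. Since omega generates B ∩ X,
   the vanishing of Ext^k(M, omega) for k > n propagates to B ∩ X by descending
   induction on k, starting above the length of some finite resolution; the
   propagation to omega^wedge is an induction on resolutions. Parts (e) and (f)
   are (c) and (d) in the opposite category.

   The exact sequences needed for Yoneda Ext only concern vanishing. Cutting an
   extension of Y by Z at its first term gives a short exact sequence
   0 -> Z -> E -> N -> 0 and an extension of Y by N, and its class is zero if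
   and only if the latter is, by a single ladder, the image of an extension of
   Y by E. That this criterion is invariant under zigzags of ladders follows
   from the existence of pullbacks of extensions along epimorphisms in the
   second variable ([seq_pullback]); with it, both dimension shifts are short
   diagram chases. *)

Set Implicit Arguments.
Unset Strict Implicit.
Unset Printing Implicit Defensive.

Import GRing.Theory.

(** * Exact sequences in abelian categories *)

Section Preadditive.
Local Open Scope ring_scope.
Local Open Scope cat_scope.
Variable C : preadditiveCategory.
Implicit Types X Y Z K E N P Q R J L S O : C.

Lemma comp0m X Y Z (f : hom X Y) : (0 : hom Y Z) ∘ f = 0.
Proof. by apply: (addrI (0 ∘ f)); rewrite -compmDl !addr0. Qed.

Lemma compm0 X Y Z (g : hom Y Z) : g ∘ (0 : hom X Y) = 0.
Proof. by apply: (addrI (g ∘ 0)); rewrite -compmDr !addr0. Qed.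

Lemma compNm X Y Z (g : hom Y Z) (f : hom X Y) : (- g) ∘ f = - (g ∘ f).
Proof. by apply: (addrI (g ∘ f)); rewrite -compmDl !subrr comp0m. Qed.

Lemma compmN X Y Z (g : hom Y Z) (f : hom X Y) : g ∘ (- f) = - (g ∘ f).
Proof. by apply: (addrI (g ∘ f)); rewrite -compmDr !subrr compm0. Qed.

Lemma compBm X Y Z (g g' : hom Y Z) (f : hom X Y) :
  (g - g') ∘ f = g ∘ f - g' ∘ f.
Proof. by rewrite compmDl compNm. Qed.

Lemma compmB X Y Z (g : hom Y Z) (f f' : hom X Y) :
  g ∘ (f - f') = g ∘ f - g ∘ f'.
Proof. by rewrite compmDr compmN. Qed.

Lemma monoP X Y (m : hom X Y) :
  mono m <-> forall T (t : hom T X), m ∘ t = 0 -> t = 0.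
Proof.
split=> [mm T t mt0 | m0 T s t mst]; first by apply: mm; rewrite mt0 compm0.
by apply/eqP; rewrite -subr_eq0; apply/eqP/m0; rewrite compmB mst subrr.
Qed.

Lemma epiP X Y (e : hom X Y) :
  epi e <-> forall T (t : hom Y T), t ∘ e = 0 -> t = 0.
Proof.
split=> [ee T t te0 | e0 T s t est]; first by apply: ee; rewrite te0 comp0m.
by apply/eqP; rewrite -subr_eq0; apply/eqP/e0; rewrite compBm est subrr.
Qed.

Lemma mono_id X : mono (idm X).
Proof. by move=> T s t; rewrite !comp1m. Qed.

Lemma epi_id X : epi (idm X).
Proof. by move=> T s t; rewrite !compm1. Qed.

Lemma mono_comp X Y Z (g : hom Y Z) (f : hom X Y) :
  mono g -> mono f -> mono (g ∘ f).
Proof. by move=> mg mf T s t; rewrite -!compmA => /mg/mf. Qed.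

Lemma epi_comp X Y Z (g : hom Y Z) (f : hom X Y) :
  epi g -> epi f -> epi (g ∘ f).
Proof. by move=> eg ef T s t; rewrite !compmA => /ef/eg. Qed.

Lemma mono_right X Y Z (g : hom Y Z) (f : hom X Y) : mono (g ∘ f) -> mono f.
Proof. by move=> mgf T s t fst; apply: mgf; rewrite -!compmA fst. Qed.

Lemma epi_left X Y Z (g : hom Y Z) (f : hom X Y) : epi (g ∘ f) -> epi g.
Proof. by move=> egf T s t fst; apply: egf; rewrite !compmA fst. Qed.

Lemma kernel_mono K X Y (g : hom X Y) (m : hom K X) : is_kernel g m -> mono m.
Proof.
move=> [gm0 km]; apply/monoP => T t mt0.
have [|s [_ us]] := km T (m ∘ t); first by rewrite mt0 compm0.
by rewrite -(us t)// (us 0)// compm0 mt0.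
Qed.

Lemma cokernel_epi X Y Q (f : hom X Y) (e : hom Y Q) : is_cokernel f e -> epi e.
Proof.
move=> [ef0 ke]; apply/epiP => T t te0.
have [|s [_ us]] := ke T (t ∘ e); first by rewrite te0 comp0m.
by rewrite -(us t)// (us 0)// comp0m te0.
Qed.

Lemma kernel_lift K X Y (g : hom X Y) (m : hom K X) T (t : hom T X) :
  is_kernel g m -> g ∘ t = 0 -> exists s, m ∘ s = t.
Proof. by move=> [_ km] /km[s [ms _]]; exists s. Qed.

Lemma cokernel_lift X Y Q (f : hom X Y) (e : hom Y Q) T (t : hom Y T) :
  is_cokernel f e -> t ∘ f = 0 -> exists s, s ∘ e = t.
Proof. by move=> [_ ke] /ke[s [es _]]; exists s. Qed.

Lemma kernelP K X Y (g : hom X Y) (m : hom K X) :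
  g ∘ m = 0 -> mono m ->
  (forall T (t : hom T X), g ∘ t = 0 -> exists s, m ∘ s = t) -> is_kernel g m.
Proof.
move=> gm0 mm lift; split=> // T t /lift[s ms]; exists s; split=> // s' ms'.
by apply: mm; rewrite ms ms'.
Qed.

Lemma cokernelP X Y Q (f : hom X Y) (e : hom Y Q) :
  e ∘ f = 0 -> epi e ->
  (forall T (t : hom Y T), t ∘ f = 0 -> exists s, s ∘ e = t) -> is_cokernel f e.
Proof.
move=> ef0 ee lift; split=> // T t /lift[s es]; exists s; split=> // s' es'.
by apply: ee; rewrite es es'.
Qed.

Definition pullback_square P X Y Z (p : hom X Z) (g : hom Y Z)
    (q1 : hom P X) (q2 : hom P Y) : Prop :=
  [/\ p ∘ q1 = g ∘ q2,
      forall T (s t : hom T P), q1 ∘ s = q1 ∘ t -> q2 ∘ s = q2 ∘ t -> s = t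
    & forall T (s : hom T X) (t : hom T Y), p ∘ s = g ∘ t ->
        exists u, q1 ∘ u = s /\ q2 ∘ u = t].

(* Equivalent to [short_exact f g], but with kernels instead of images. *)
Definition ses X Y Z (f : hom X Y) (g : hom Y Z) : Prop :=
  is_kernel g f /\ epi g.

Lemma ses0 X Y Z (f : hom X Y) (g : hom Y Z) : ses f g -> g ∘ f = 0.
Proof. by move=> [[]]. Qed.

Lemma ses_mono X Y Z (f : hom X Y) (g : hom Y Z) : ses f g -> mono f.
Proof. by move=> [/kernel_mono]. Qed.

Lemma ses_epi X Y Z (f : hom X Y) (g : hom Y Z) : ses f g -> epi g.
Proof. by move=> []. Qed.

Lemma ses_lift X Y Z (f : hom X Y) (g : hom Y Z) T (t : hom T Y) :
  ses f g -> g ∘ t = 0 -> exists s, f ∘ s = t.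
Proof. by move=> [kf _]; apply: kernel_lift. Qed.

Lemma is_zero_object_to Z X (f g : hom X Z) : is_zero_object Z -> f = g.
Proof. by move=> /(_ X)[[h [_ hu]] _]; rewrite -(hu f)// (hu g). Qed.

Lemma is_zero_object_from Z X (f g : hom Z X) : is_zero_object Z -> f = g.
Proof. by move=> /(_ X)[_ [h [_ hu]]]; rewrite -(hu f)// (hu g). Qed.

Lemma ses_zero_source Z X Y (f : hom Z X) (g : hom X Y) (h : hom Y X) :
  is_zero_object Z -> g ∘ h = idm Y -> h ∘ g = idm X -> ses f g.
Proof.
move=> Z0 gh hg; split; last first.
  by apply: (@epi_left _ _ _ g h); rewrite gh; apply: epi_id.
apply: kernelP; first by apply: is_zero_object_from.
  by move=> T s t _; apply: is_zero_object_to.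
move=> T t gt0; exists 0.
by rewrite compm0 -(comp1m t) -hg -compmA gt0 compm0.
Qed.

Lemma ses_zero_target Z X Y (f : hom X Y) (g : hom Y Z) (h : hom Y X) :
  is_zero_object Z -> f ∘ h = idm Y -> h ∘ f = idm X -> ses f g.
Proof.
move=> Z0 fh hf; split; last first.
  by move=> T s t _; apply: is_zero_object_from.
apply: kernelP; first by apply: is_zero_object_to.
  by apply: (@mono_right _ _ _ h f); rewrite hf; apply: mono_id.
by move=> T t _; exists (h ∘ t); rewrite compmA fh comp1m.
Qed.

(** The objects are those of [C] up to conversion, so a class of objects of [C] is also one of the
    opposite category, without transport. *)
Definition opp_category : preadditiveCategory :=
  @PreadditiveCategory C (fun X Y => hom Y X) (fun X => idm X)
    (fun X Y Z g f => f ∘ g)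
    (fun X Y f => compm1 f) (fun X Y f => comp1m f)
    (fun W X Y Z h g f => esym (compmA f g h))
    (fun X Y Z g g' f => compmDr f g g')
    (fun X Y Z g f f' => compmDl f f' g).

End Preadditive.

(** * The opposite of an abelian category *)

Section OppAbelian.
Local Open Scope cat_scope.
Variable C : abelianCategory.

Fact opp_zero_object_ex : exists Z : opp_category C, is_zero_object Z.
Proof.
by have [Z Z0] := zero_object_ex C; exists Z => X; have [] := Z0 X; split.
Qed.

Fact opp_is_biproduct (X Y S : C) :
  is_biproduct X Y S -> @is_biproduct (opp_category C) X Y S.
Proof. by move=> [i1 [i2 [p1 [p2 [? ? ? ? ?]]]]]; exists p1, p2, i1, i2. Qed.

Fact opp_biproduct_ex (X Y : opp_category C) : exists S, is_biproduct X Y S.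
Proof.
by have [S XYS] := biproduct_ex X Y; exists S; apply: opp_is_biproduct.
Qed.

Definition opp_abelian : abelianCategory :=
  @AbelianCategory (opp_category C) opp_zero_object_ex opp_biproduct_ex
    (fun X Y f => cokernel_ex f) (fun X Y f => kernel_ex f)
    (fun X Y m mm => epi_normal mm) (fun X Y e ee => mono_normal ee).

End OppAbelian.

(** * Kernels, cokernels and pullbacks in abelian categories *)

Section AbelianLemmas.
Local Open Scope ring_scope.
Local Open Scope cat_scope.
Variable C : abelianCategory.
Implicit Types X Y Z K E N P Q R J L S O : C.

(** The epimorphism [g] is the cokernel of some [h], and [h] factors through the kernel [f]; what
    kills [f] thus kills [h]. *)
Lemma ses_cokernel X Y Z (f : hom X Y) (g : hom Y Z) :
  ses f g -> is_cokernel f g.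
Proof.
move=> [kf eg]; have [W [h ch]] := epi_normal eg.
have [s fs] : exists s, f ∘ s = h by apply: (kernel_lift kf); case: ch.
apply: cokernelP => //; first by case: kf.
by move=> T t tf0; apply: (cokernel_lift ch); rewrite -fs compmA tf0 comp0m.
Qed.

Lemma cokernel_ses X Y Z (f : hom X Y) (g : hom Y Z) :
  mono f -> is_cokernel f g -> ses f g.
Proof.
move=> mf cg; split; last exact: cokernel_epi cg.
have [W [h kh]] := mono_normal mf.
have [s sg] : exists s, s ∘ g = h by apply: (cokernel_lift cg); case: kh.
apply: kernelP => //; first by case: cg.
by move=> T t gt0; apply: (kernel_lift kh); rewrite -sg -compmA gt0 compm0.
Qed.

Lemma ses_colift X Y Z (f : hom X Y) (g : hom Y Z) T (t : hom Y T) :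
  ses f g -> t ∘ f = 0 -> exists s, s ∘ g = t.
Proof. by move=> /ses_cokernel cg; apply: cokernel_lift. Qed.

(** As a mono, [f] is the kernel of some [h], which is zero because [f] is epi; hence the identity
    lifts through [f]. *)
Lemma mono_epi_iso X Y (f : hom X Y) :
  mono f -> epi f -> exists g, g ∘ f = idm X /\ f ∘ g = idm Y.
Proof.
move=> mf ef; have [W [h kh]] := mono_normal mf.
have h0 : h = 0 by apply: (epiP _).1 ef _ _ _; case: kh.
have [|s fs] := kernel_lift (t := idm Y) kh; first by rewrite h0 comp0m.
by exists s; split=> //; apply: mf; rewrite compmA fs comp1m compm1.
Qed.

Lemma short_exactP X Y Z (f : hom X Y) (g : hom Y Z) :
  short_exact f g <-> ses f g.
Proof.
split=> [[mf [I [m [[mm [e ee fme]] km]]] eg] | [kf eg]].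
  split=> //; have [|e' [e'e ee']] := mono_epi_iso (f := e) _ ee.
    by apply: (@mono_right _ _ _ _ m); rewrite -fme.
  apply: kernelP => //.
    by rewrite fme compmA; case: km => -> _; rewrite comp0m.
  move=> T t /(kernel_lift km)[s <-]; exists (e' ∘ s).
  by rewrite fme -compmA (compmA e) ee' comp1m.
have mf := kernel_mono kf; split=> //; exists X, f; split=> //; split=> //.
by exists (idm X); [apply: epi_id | rewrite compm1].
Qed.

Lemma ses_iso_right X Y Z Z' (f : hom X Y) (g : hom Y Z) (h : hom Z Z') :
  mono h -> epi h -> ses f g -> ses f (h ∘ g).
Proof.
move=> mh eh fg; split; last by apply: epi_comp => //; apply: ses_epi fg.
apply: kernelP; first by rewrite -compmA (ses0 fg) compm0.
  exact: ses_mono fg.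
move=> T t; rewrite -compmA => /((monoP _).1 mh); exact: ses_lift.
Qed.

Lemma ses_iso_left X' X Y Z (f : hom X Y) (g : hom Y Z) (h : hom X' X) :
  mono h -> epi h -> ses f g -> ses (f ∘ h) g.
Proof.
move=> mh eh fg; have [h' [h'h hh']] := mono_epi_iso mh eh.
split; last exact: ses_epi fg.
apply: kernelP; first by rewrite compmA (ses0 fg) comp0m.
  by apply: mono_comp => //; apply: ses_mono fg.
move=> T t /(ses_lift fg)[s <-]; exists (h' ∘ s).
by rewrite -compmA (compmA h) hh' comp1m.
Qed.

Lemma ses_biproduct X Y : exists S (i1 : hom X S) (i2 : hom Y S)
  (p1 : hom S X) (p2 : hom S Y),
  [/\ p1 ∘ i1 = idm X, p2 ∘ i2 = idm Y, p1 ∘ i2 = 0, p2 ∘ i1 = 0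
    & i1 ∘ p1 + i2 ∘ p2 = idm S] /\ ses i1 p2.
Proof.
have [S [i1 [i2 [p1 [p2 [e1 e2 e3 e4 e5]]]]]] := biproduct_ex X Y.
exists S, i1, i2, p1, p2; split=> //; split.
  apply: kernelP => //.
    by apply: (@mono_right _ _ _ _ p1); rewrite e1; apply: mono_id.
  move=> T t p2t; exists (p1 ∘ t).
  by rewrite -[RHS]comp1m -e5 compmDl -!compmA p2t compm0 addr0.
by apply: (@epi_left _ _ _ _ _ i2); rewrite e2; apply: epi_id.
Qed.

(** The pullback is the kernel of the difference morphism [d] from the biproduct of [X] and [Y] to
    [Z]. *)
Lemma pullback_ex X Y Z (p : hom X Z) (g : hom Y Z) :
  exists P (q1 : hom P X) (q2 : hom P Y),
    pullback_square p g q1 q2 /\ (epi p -> epi q2).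
Proof.
have [S [i1 [i2 [p1 [p2 [[e1 e2 e3 e4 e5] _]]]]]] := ses_biproduct X Y.
pose d := p ∘ p1 - g ∘ p2.
have [P [m km]] := kernel_ex d; have mm := kernel_mono km.
exists P, (p1 ∘ m), (p2 ∘ m); split.
  split.
  - by apply/eqP; rewrite -subr_eq0 !compmA -compBm -/d; apply/eqP; case: km.
  - move=> T s t; rewrite -!compmA => s1 s2; apply: mm.
    by rewrite -(comp1m (m ∘ s)) -(comp1m (m ∘ t)) -e5 !compmDl -!compmA s1 s2.
  move=> T s t pq; have [|u mu] := kernel_lift (t := i1 ∘ s + i2 ∘ t) km.
    rewrite /d compBm !compmDr -!compmA !(compmA p1) !(compmA p2).
    by rewrite e1 e2 e3 e4 !comp1m !comp0m !compm0 addr0 add0r pq subrr.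
  exists u; rewrite -!compmA mu !compmDr !compmA e1 e2 e3 e4.
  by rewrite !comp1m !comp0m addr0 add0r.
(* If [p] is epi, so is [d], which is then the cokernel of [m]. When [t ∘ p2] kills [m] it equals
   some [w ∘ d], and restriction to [X] forces [w = 0]. *)
move=> ep; have ed : epi d.
  apply: (@epi_left _ _ _ _ _ i1).
  by rewrite /d compBm -!compmA e1 e4 compm1 compm0 subr0.
apply/epiP => T t; rewrite compmA => tm0.
have [w wd] : exists w, w ∘ d = t ∘ p2 by apply: (ses_colift (f := m)).
have w0 : w = 0.
  apply: (epiP _).1 ep _ _ _.
  have := congr1 (fun z => z ∘ i1) wd; rewrite -!compmA e4 compm0 => <-.
  by rewrite /d compBm -!compmA e1 e4 compm1 compm0 subr0.
by rewrite -(compm1 t) -e2 compmA -wd w0 !comp0m.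
Qed.

Lemma pullback_epi P X Y Z (p : hom X Z) (g : hom Y Z)
    (q1 : hom P X) (q2 : hom P Y) :
  pullback_square p g q1 q2 -> epi p -> epi q2.
Proof.
move=> [_ _ univ] ep.
have [P0 [r1 [r2 [[r12 _ _] /(_ ep) er2]]]] := pullback_ex p g.
have [u [_ q2u]] := univ _ _ _ r12.
by apply: (@epi_left _ _ _ _ _ u); rewrite q2u.
Qed.

(** Stands in for choosing preimages of elements: a generalized element lifts along an epimorphism
    after passing to a cover of its domain. *)
Lemma epi_cover X Y T (p : hom X Y) (t : hom T Y) :
  epi p -> exists T' (c : hom T' T) s, epi c /\ p ∘ s = t ∘ c.
Proof.
by move=> ep; have [P [q1 [q2 [[sq _ _] /(_ ep) eq2]]]] := pullback_ex p t;
  exists P, q2, q1.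
Qed.

Lemma epi_coverP X Y (p : hom X Y) :
  (forall T (t : hom T Y),
     exists T' (c : hom T' T) s, epi c /\ p ∘ s = t ∘ c) -> epi p.
Proof.
move=> /(_ Y (idm Y))[T' [c [s [ec]]]]; rewrite comp1m => ps.
by apply: (@epi_left _ _ _ _ p s); rewrite ps.
Qed.

Lemma ses_pullback K E N Y (a : hom K E) (b : hom E N) (t : hom Y N) :
  ses a b -> exists E' (a' : hom K E') (b' : hom E' Y) (e : hom E' E),
    [/\ ses a' b', e ∘ a' = a & pullback_square b t e b'].
Proof.
move=> ab; have [P [q1 [q2 [sq eq2]]]] := pullback_ex b t.
have [sq0 jm univ] := sq.
have [|a' [q1a' q2a']] := univ K a 0; first by rewrite (ses0 ab) compm0.
exists P, a', q2, q1; split=> //; split; last exact: eq2 (ses_epi ab).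
apply: kernelP => //.
  by apply: (@mono_right _ _ _ _ q1); rewrite q1a'; apply: ses_mono ab.
move=> T s q2s; have [|r ar] := ses_lift (t := q1 ∘ s) ab.
  by rewrite compmA sq0 -compmA q2s compm0.
exists r; apply: jm; first by rewrite compmA q1a'.
by rewrite compmA q2a' comp0m q2s.
Qed.

(** A morphism into [E] killed by [r ∘ b] is sent by [b] into the subobject [Y], hence factors
    through the pullback. Dually, this gives the kernel of a pushout along an epimorphism. *)
Lemma ses_pullback_mono E' E N Y R (b : hom E N) (t : hom Y N)
    (e : hom E' E) (b' : hom E' Y) (r : hom N R) :
  pullback_square b t e b' -> epi b -> ses t r -> ses e (r ∘ b).
Proof.
move=> [sq jm univ] eb tr; split; last exact: epi_comp (ses_epi tr) eb.
apply: kernelP; first by rewrite -compmA sq compmA (ses0 tr) comp0m.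
  move=> T s s' ess'; apply: jm => //; apply: (ses_mono tr).
  by rewrite !compmA -sq -!compmA ess'.
move=> T s; rewrite -compmA => /(ses_lift tr)[u tu].
by have [|v [ev _]] := univ _ s u; [rewrite tu | exists v].
Qed.

Lemma ses_pullback_epi E' E N Y J (b : hom E N) (t : hom Y N)
    (e : hom E' E) (b' : hom E' Y) (j : hom J Y) :
  pullback_square b t e b' -> ses j t ->
  exists j' : hom J E', ses j' e /\ b' ∘ j' = j.
Proof.
move=> [sq jm univ] jt.
have [|j' [ej' b'j']] := univ _ 0 j; first by rewrite compm0 (ses0 jt).
exists j'; split=> //; split; last first.
  apply: (@pullback_epi _ _ _ _ t b b'); last exact: ses_epi jt.
  split=> // [T s s' h1 h2|T s s' h]; first exact: jm.
  by have [|u [u1 u2]] := univ _ s' s; last exists u.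
apply: kernelP => //.
  by apply: (@mono_right _ _ _ _ b'); rewrite b'j'; apply: ses_mono jt.
move=> T s es; have [|r jr] := ses_lift (t := b' ∘ s) jt.
  by rewrite compmA -sq -compmA es compm0.
exists r; apply: jm; first by rewrite compmA ej' comp0m es.
by rewrite compmA b'j'.
Qed.

(* Pullback of three short exact sequences along two morphisms of exact
   sequences, the first of which has an epimorphic left component. *)
Lemma ses_pullback3 K1 E1 N1 K E N K2 E2 N2 KP EP NP
    (a1 : hom K1 E1) (b1 : hom E1 N1) (a : hom K E) (b : hom E N)
    (a2 : hom K2 E2) (b2 : hom E2 N2)
    (p : hom K1 K) (e : hom E1 E) (n : hom N1 N)
    (g : hom K2 K) (u : hom E2 E) (v : hom N2 N)
    (k1 : hom KP K1) (k2 : hom KP K2) (e1 : hom EP E1) (e2 : hom EP E2)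
    (n1 : hom NP N1) (n2 : hom NP N2) :
  ses a1 b1 -> ses a b -> ses a2 b2 ->
  e ∘ a1 = a ∘ p -> n ∘ b1 = b ∘ e -> u ∘ a2 = a ∘ g -> v ∘ b2 = b ∘ u ->
  pullback_square p g k1 k2 -> pullback_square e u e1 e2 ->
  pullback_square n v n1 n2 -> epi p ->
  exists (aP : hom KP EP) (bP : hom EP NP),
    [/\ ses aP bP, e1 ∘ aP = a1 ∘ k1, e2 ∘ aP = a2 ∘ k2,
        n1 ∘ bP = b1 ∘ e1 & n2 ∘ bP = b2 ∘ e2].
Proof.
move=> s1 s s2 ea nb ua vb [ksq kjm kun] [esq ejm eun] [nsq njm nun] ep.
have [|aP [e1a e2a]] := eun _ (a1 ∘ k1) (a2 ∘ k2).
  by rewrite !compmA ea ua -!compmA ksq.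
have [|bP [n1b n2b]] := nun _ (b1 ∘ e1) (b2 ∘ e2).
  by rewrite !compmA nb vb -!compmA esq.
exists aP, bP; split=> //; split; first apply: kernelP.
- apply: njm; rewrite compm0 compmA ?n1b ?n2b -compmA ?e1a ?e2a compmA.
    by rewrite (ses0 s1) comp0m.
  by rewrite (ses0 s2) comp0m.
- move=> T x y xy; apply: kjm.
    by apply: (ses_mono s1); rewrite !compmA -e1a -!compmA xy.
  by apply: (ses_mono s2); rewrite !compmA -e2a -!compmA xy.
- move=> T t bt0.
  have [|t1 t1E] := ses_lift (t := e1 ∘ t) s1.
    by rewrite compmA -n1b -compmA bt0 compm0.
  have [|t2 t2E] := ses_lift (t := e2 ∘ t) s2.
    by rewrite compmA -n2b -compmA bt0 compm0.
  have [|w [w1 w2]] := kun _ t1 t2.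
    apply: (ses_mono s); rewrite !compmA -ea -ua -!compmA t1E t2E.
    by rewrite !compmA esq.
  exists w; apply: ejm; first by rewrite compmA e1a -compmA w1.
  by rewrite compmA e2a -compmA w2.
(* On covers, the two components of [t] lift to [x1] and [x2], whose images in [E] differ by
   [a ∘ k]. Lifting [k] along [p] to [l] and subtracting [a1 ∘ l] from [x1] makes them agree. *)
apply: epi_coverP => T t.
have [T1 [c1 [x1 [ec1 x1E]]]] := epi_cover (n1 ∘ t) (ses_epi s1).
have [T2 [c2 [x2 [ec2 x2E]]]] := epi_cover (n2 ∘ t ∘ c1) (ses_epi s2).
have [k kE] : exists k, a ∘ k = e ∘ (x1 ∘ c2) - u ∘ x2.
  apply: (ses_lift s); rewrite compmB !compmA -nb -vb.
  rewrite -(compmA n b1) x1E -(compmA v b2) x2E !compmA nsq subrr //.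
have [T3 [c3 [l [ec3 lE]]]] := epi_cover k ep.
have [|w [w1 w2]] := eun _ (x1 ∘ c2 ∘ c3 - a1 ∘ l) (x2 ∘ c3).
  rewrite compmB !compmA ea -(compmA a) lE compmA kE compBm !compmA.
  by rewrite opprB addrC subrK.
exists T3, (c1 ∘ c2 ∘ c3), w; split; first by do !apply: epi_comp.
apply: njm.
  rewrite compmA n1b -compmA w1 compmB !compmA (ses0 s1) comp0m subr0.
  by rewrite x1E.
by rewrite compmA n2b -compmA w2 !compmA x2E.
Qed.

End AbelianLemmas.

(** * Extensions cut into short exact sequences *)

Section ExtensionSequences.
Local Open Scope ring_scope.
Local Open Scope cat_scope.
Variable C : abelianCategory.
Implicit Types X Y Z K E N P Q R J L S O : C.

(** Dual of the pullback lemmas. The last two clauses say that a pushout along a mono keeps the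
    cokernel, and along an epi keeps the kernel. *)
Lemma ses_pushout K E N K' (a : hom K E) (b : hom E N) (f : hom K K') :
  ses a b -> exists E' (a' : hom K' E') (b' : hom E' N) (e : hom E E'),
    [/\ ses a' b', b' ∘ e = b, e ∘ a = a' ∘ f,
        (forall T (s : hom E T) (t : hom K' T), s ∘ a = t ∘ f ->
           exists u, u ∘ e = s /\ u ∘ a' = t)
      & (forall T (s t : hom E' T), s ∘ e = t ∘ e -> s ∘ a' = t ∘ a' -> s = t)]
    /\ (forall K'' (g : hom K' K''), ses f g ->
          exists h : hom E' K'', ses e h /\ h ∘ a' = g)
    /\ (forall J (j : hom J K), ses j f -> ses (a ∘ j) e).
Proof.
have op_ses X Y Z (u : hom X Y) (v : hom Y Z) :
    ses u v -> @ses (opp_abelian C) Z Y X v u.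
  by move=> uv; split; [exact (ses_cokernel uv) | exact (ses_mono uv)].
have ses_op X Y Z (u : hom X Y) (v : hom Y Z) :
    @ses (opp_abelian C) Z Y X v u -> ses u v.
  by move=> [cu mu]; exact (@cokernel_ses _ _ _ _ u v mu cu).
move=> ab; have [E' [b' [a' [e [ab' be sq]]]]] :=
  @ses_pullback (opp_abelian C) _ _ _ _ _ _ f (op_ses _ _ _ _ _ ab).
exists E', a', b', e; split.
  by have [ea jm univ] := sq; split=> //; apply: ses_op.
split=> [K'' g fg|J j jf].
  have [h [eh ha']] := ses_pullback_epi sq (op_ses _ _ _ _ _ fg).
  by exists h; split=> //; apply: ses_op.
apply: ses_op; apply: (ses_pullback_mono sq); last exact: op_ses.
exact: ses_mono ab.
Qed.

Record ses_then (F : C -> Type) (K : C) := SesThen {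
  st_mid : C;
  st_quo : C;
  st_in : hom K st_mid;
  st_out : hom st_mid st_quo;
  st_ses : ses st_in st_out;
  st_tail : F st_quo }.

Variable Y : C.

(* Exact sequences 0 -> K -> E_1 -> ... -> E_k -> N -> 0 cut into short exact
   sequences, with a morphism Y -> N: the pullback along it is an extension of
   Y by K, so they represent the elements of Ext^k(Y, K), and [seq_map f x x']
   expresses that x' is the image of x under Ext^k(Y, f). For k = 0 this is
   Hom(Y, K). *)
Fixpoint ext_seq (k : nat) : C -> Type :=
  if k is k'.+1 then ses_then (ext_seq k') else hom Y.

Fixpoint seq_map (k : nat) K K' (f : hom K K') :
    ext_seq k K -> ext_seq k K' -> Prop :=
  match k return ext_seq k K -> ext_seq k K' -> Prop with
  | 0 => fun x x' => f ∘ x = x'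
  | k'.+1 => fun x x' => exists e n,
      [/\ e ∘ st_in x = st_in x' ∘ f, n ∘ st_out x = st_out x' ∘ e
        & seq_map n (st_tail x) (st_tail x')]
  end.

Lemma seq_map_id k K (x : ext_seq k K) : seq_map (idm K) x x.
Proof.
elim: k K x => [|k IH] K x /=; first exact: comp1m.
by exists (idm _), (idm _); rewrite !comp1m !compm1.
Qed.

Lemma seq_map_comp k K K' K'' (g : hom K' K'') (f : hom K K') x x' x'' :
  seq_map f x x' -> seq_map g x' x'' -> @seq_map k _ _ (g ∘ f) x x''.
Proof.
elim: k K K' K'' g f x x' x'' => [|k IH] K K' K'' g f x x' x'' /=.
  by move=> <- <-; rewrite compmA.
move=> [e [n [ea nb t]]] [e' [n' [ea' nb' t']]]; exists (e' ∘ e), (n' ∘ n).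
split; last exact: IH t t'.
  by rewrite -compmA ea !compmA ea'.
by rewrite -compmA nb !compmA nb'.
Qed.

(** In positive length only the first short exact sequence is pushed out; the tail stays, and the
    second clause comes from the universal property of the pushout. *)
Lemma seq_push k K K' (f : hom K K') (x : ext_seq k K) :
  exists x', seq_map f x x' /\
    forall K'' (g : hom K' K'') x'', seq_map (g ∘ f) x x'' -> seq_map g x' x''.
Proof.
case: k x => [x|k x] /=.
  by exists (f ∘ x); split=> // K'' g x'' <-; rewrite compmA.
have [E' [a' [b' [e [[s be ea univ jm] _]]]]] := ses_pushout f (st_ses x).
exists (SesThen s (st_tail x)); split=> /=.
  by exists e, (idm _); split; rewrite ?comp1m ?be//; apply: seq_map_id.
move=> K'' g x'' [e'' [n [ea'' nb t]]].
have [|u [ue ua]] := univ _ e'' (st_in x'' ∘ g); first by rewrite ea'' compmA.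
exists u, n; split=> //; apply: jm; first by rewrite -compmA be nb -compmA ue.
rewrite -!compmA (ses0 s) ua compmA (ses0 (st_ses x'')).
by rewrite comp0m compm0.
Qed.

(* The induction needs n : N1 -> N to be an epimorphism; this is achieved by
   adding the middle term E to E1 and to N1. *)
Lemma seq_pullback k K1 K K2 P (p : hom K1 K) (g : hom K2 K)
    (q1 : hom P K1) (q2 : hom P K2) (x1 : ext_seq k K1) x x2 :
  pullback_square p g q1 q2 -> epi p -> seq_map p x1 x -> seq_map g x2 x ->
  exists z, seq_map q2 z x2.
Proof.
elim: k K1 K K2 P p g q1 q2 x1 x x2 => [|k IH] K1 K K2 P p g q1 q2 x1 x x2 /=.
  move=> [_ _ univ] _ px gx.
  by have [|u [_ u2]] := univ _ x1 x2; [rewrite px gx | exists u].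
move=> sq ep [e [n [ea nb t]]] [u [v [ua vb t2]]].
case: x x1 x2 e n ea nb t u v ua vb t2
  => [E N a b s x] [E1 N1 a1 b1 s1 x1] [E2 N2 a2 b2 s2 x2] /=.
move=> e n ea nb t u v ua vb t2.
have [EE [i1 [i2 [p1 [p2 [[e1 e2 e3 e4 e5] _]]]]]] := ses_biproduct E1 E.
have [NN [j1 [j2 [r1 [r2 [[f1 f2 f3 f4 f5] _]]]]]] := ses_biproduct N1 E.
have sE : ses (i1 ∘ a1) (j1 ∘ b1 ∘ p1 + j2 ∘ p2).
  split; first apply: kernelP.
  - rewrite compmDl -!compmA (compmA p1) (compmA p2) e1 e4.
    by rewrite comp1m comp0m (ses0 s1) !compm0 addr0.
  - apply: mono_comp; last exact: ses_mono s1.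
    by apply: (@mono_right _ _ _ _ p1); rewrite e1; apply: mono_id.
  - move=> T w w0.
    have p2w : p2 ∘ w = 0.
      have := congr1 (fun z => r2 ∘ z) w0.
      by rewrite compm0 compmDl compmDr !compmA f2 f4 !comp0m comp1m add0r.
    have [|y ay] := ses_lift (t := p1 ∘ w) s1.
      have := congr1 (fun z => r1 ∘ z) w0.
      by rewrite compm0 compmDl compmDr !compmA f1 f3 !comp0m comp1m addr0.
    exists y; rewrite -compmA ay -[RHS]comp1m -e5 compmDl -!compmA p2w.
    by rewrite compm0 addr0.
  apply/epiP => T w; rewrite compmDr !compmA => w0.
  have wj1 : w ∘ j1 = 0.
    apply: (epiP _).1 (ses_epi s1) _ _ _.
    have := congr1 (fun z => z ∘ i1) w0.
    by rewrite comp0m compmDl -!compmA e1 e4 !compm0 addr0 compm1.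
  have wj2 : w ∘ j2 = 0.
    have := congr1 (fun z => z ∘ i2) w0.
    by rewrite comp0m compmDl -!compmA e2 e3 !compm0 add0r compm1.
  by rewrite -(compm1 w) -f5 compmDr !compmA wj1 wj2 !comp0m addr0.
(* The morphism [n ∘ r1 + b ∘ r2] is epi because [b] is, and it restricts to [n] along [j1], so the
   tail pushed along [j1] still maps to [x]. *)
have [y [xy yu]] := seq_push j1 x1.
have [P2 [k1 [k2 [sqN _]]]] := pullback_ex (n ∘ r1 + b ∘ r2) v.
have [PE [l1 [l2 [sqE _]]]] := pullback_ex (e ∘ p1 + p2) u.
have [||aP [bP [sP c1 c2 c3 c4]]] :=
  ses_pullback3 (e := e ∘ p1 + p2) (n := n ∘ r1 + b ∘ r2) sE s s2
     _ _ ua vb sq sqE sqN ep.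
- rewrite compmDl -!compmA (compmA p1) (compmA p2) e1 e4.
  by rewrite comp1m comp0m addr0.
- rewrite compmDl !compmDr -!compmA !(compmA r1) !(compmA r2).
  rewrite f1 f2 f3 f4 !comp1m !comp0m !compm0 addr0 add0r.
  by rewrite !compmA nb.
have [||z kz] := IH _ _ _ _ _ _ _ _ y x x2 sqN _ _ t2.
- apply: (@epi_left _ _ _ _ _ j2).
  rewrite compmDl -!compmA f2 f3 compm0 compm1 add0r.
  exact: ses_epi s.
- by apply: yu; rewrite compmDl -!compmA f1 f4 compm0 compm1 addr0.
by exists (SesThen sP z), l2, k2; split.
Qed.

(* The vanishing of Ext^(k+1)(Y, Z): by the long exact sequences of the
   0 -> Z -> E -> N -> 0, it means that Ext^k(Y, E) -> Ext^k(Y, N) is always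
   surjective. *)
Definition ext_vanish (k : nat) Z : Prop :=
  forall E N (a : hom Z E) (b : hom E N), ses a b ->
  forall x : ext_seq k N, exists y : ext_seq k E, seq_map b y x.

(** The class of [x] is the image of its tail under the connecting morphism, so it is zero when the
    tail comes from the middle term. *)
Definition null_seq (k : nat) Z (x : ext_seq k.+1 Z) : Prop :=
  exists y, seq_map (st_out x) y (st_tail x).

(** Forward, the witness is pushed along [e]. Backward, the left component being an identity, the
    right-hand square is a pullback and [seq_pullback] lifts the witness. *)
Lemma null_seq_map k Z (x x' : ext_seq k.+1 Z) :
  seq_map (idm Z) x x' -> (null_seq x <-> null_seq x').
Proof.
move=> [e [n [ea nb t]]]; split=> [[y yx]|[y yx]].
  have := seq_map_comp yx t; rewrite nb => yx'.
  by have [y' [_ /(_ _ _ _ yx')]] := seq_push e y; exists y'.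
case: x x' e n ea nb t y yx => [E N a b s x] [E' N' a' b' s' x'] /=.
move=> e n; rewrite compm1 => ea nb t y yx.
have sq : pullback_square b' n e b.
  split=> // [T v w ev bv|T v w bv].
    apply/eqP; rewrite -subr_eq0; apply/eqP.
    have [|r ar] := ses_lift (t := v - w) s; first by rewrite compmB bv subrr.
    suff r0 : r = 0 by rewrite -ar r0 compm0.
    apply: (monoP _).1 (ses_mono s') _ _ _.
    by rewrite -ea -compmA ar compmB ev subrr.
  have [T1 [c [w' [ec w'E]]]] := epi_cover w (ses_epi s).
  have [r rE] : exists r, a' ∘ r = v ∘ c - e ∘ w'.
    by apply: (ses_lift s'); rewrite compmB !compmA bv -nb -!compmA w'E subrr.
  (* the lift [w' + a r] defined on the cover T1 descends to T *)
  have [K0 [m km]] := kernel_ex c.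
  have cc : ses m c by split.
  have wm0 : (w' + a ∘ r) ∘ m = 0.
    have [|r' ar'] := ses_lift (t := (w' + a ∘ r) ∘ m) s.
      rewrite compmA compmDr compmA (ses0 s) comp0m addr0 w'E -compmA.
      by rewrite (ses0 cc) compm0.
    rewrite -ar'; suff -> : r' = 0 by rewrite compm0.
    apply: (monoP _).1 (ses_mono s') _ _ _.
    rewrite -ea -compmA ar' compmA compmDr compmA ea rE addrC subrK -compmA.
    by rewrite (ses0 cc) compm0.
  have [w0 w0E] := ses_colift cc wm0.
  exists w0; split; apply: (ec); rewrite -compmA w0E compmDr compmA.
    by rewrite ea rE addrC subrK.
  by rewrite (ses0 s) comp0m addr0.
have [z bz] := seq_pullback sq (ses_epi s') yx t.
by exists z.
Qed.

Lemma ext_vanishP k Z :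
  ext_vanish k Z <-> forall x : ext_seq k.+1 Z, null_seq x.
Proof.
split=> [V x|V E N a b s x]; first exact: V (st_ses x) _.
exact: V (SesThen s x).
Qed.

(** Exactness of Ext^(k+1)(Y, Z) -> Ext^(k+1)(Y, Z'') -> Ext^(k+2)(Y, Z'): a class at [Z''] lifts to
    one at [Z], which is null, and the witness is pushed along [e]. *)
Lemma ext_vanish_target k Z' Z Z'' (f : hom Z' Z) (g : hom Z Z'') :
  ses f g -> ext_vanish k Z -> ext_vanish k.+1 Z' -> ext_vanish k Z''.
Proof.
move=> fg VZ VZ' E N a b s x.
have [y [e [n [/= ea nb t]]]] := VZ' _ _ _ _ fg (SesThen s x).
have [w wy] := VZ _ _ _ _ (st_ses y) (st_tail y).
have := seq_map_comp wy t; rewrite nb => wx.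
by have [z [_ /(_ _ _ _ wx)]] := seq_push e w; exists z.
Qed.

(** Exactness of Ext^(k+1)(Y, Z'') -> Ext^(k+2)(Y, Z') -> Ext^(k+2)(Y, Z). The pushout [T'] of [T]
    along [f] is an extension of [Z''] by [T]; [x] lifts to [T'], and the obstruction to lifting on
    to [T] lies over [Z'']. *)
Lemma ext_vanish_source k Z' Z Z'' (f : hom Z' Z) (g : hom Z Z'') :
  ses f g -> ext_vanish k Z'' -> ext_vanish k.+1 Z -> ext_vanish k.+1 Z'.
Proof.
move=> fg VZ'' VZ T L a b s x.
have [T' [a' [b' [u [[s' bu ua _ _] [/(_ _ _ fg)[h [uh _]] _]]]]]] :=
  ses_pushout f s.
have [y yx] := VZ _ _ _ _ s' x.
have [RQ [a2 [b2 [r [[s2 br _ _ _] [_ /(_ _ _ uh) ur]]]]]] :=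
  ses_pushout h (st_ses y).
have [w wy] := VZ'' _ _ _ _ s2 (st_tail y).
have zy : seq_map u (SesThen ur w : ext_seq k.+1 T) y.
  by exists (idm _), b2; rewrite /= comp1m compm1 br; split.
by exists (SesThen ur w); have := seq_map_comp zy yx; rewrite bu.
Qed.

(** A sequence of zero objects, which serves as the tail of the trivial extension. *)
Lemma seq_terminal k O : is_zero_object O ->
  exists x0 : ext_seq k O, forall K (f : hom K O) x, seq_map f x x0.
Proof.
move=> O0; elim: k => [|k [x0 x0E]] /=.
  by exists 0 => K f x; apply: is_zero_object_to.
have s : ses (0 : hom O O) (0 : hom O O).
  by apply: (@ses_zero_source _ _ _ _ _ _ 0) => //; apply: is_zero_object_to.
exists (SesThen s x0) => K f x; exists 0, 0; split=> //;
  exact: is_zero_object_to.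
Qed.

End ExtensionSequences.

(** * Yoneda extensions *)

Section Chains.
Local Open Scope ring_scope.
Local Open Scope cat_scope.
Variable C : abelianCategory.
Implicit Types X Y Z K E N P Q R J L S O T : C.

Definition chain_pre n K' K Y (b : hom K' K) : chain n K Y -> chain n K' Y :=
  match n return chain n K Y -> chain n K' Y with
  | 0 => fun c => c ∘ b
  | n'.+1 => fun c => let: existT E (g, d) := c in existT _ E (g ∘ b, d)
  end.

Fixpoint chain_post n K Y Y' (b : hom Y Y') : chain n K Y -> chain n K Y' :=
  match n return chain n K Y -> chain n K Y' with
  | 0 => fun c => b ∘ c
  | n'.+1 => fun c => let: existT E (g, d) := c in
                      existT _ E (g, chain_post b d)
  end.

Fixpoint chain_rcons n X Y Z (c : chain n X Y) (h : hom Y Z) : chain n.+1 X Z :=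
  match n return chain n X Y -> chain n.+1 X Z with
  | 0 => fun c => existT _ Y (c, h)
  | n'.+1 => fun c => let: existT E (g, d) := c in
                      existT _ E (g, chain_rcons d h)
  end c.

Lemma chain_rcons_pre n X' X Y Z (b : hom X' X) (c : chain n X Y)
    (h : hom Y Z) :
  chain_rcons (chain_pre b c) h = chain_pre b (chain_rcons c h).
Proof. by case: n c => [|n] // [E [g d]]. Qed.

Lemma chain_post_pre n X' X Y Z (b : hom X' X) (c : chain n X Y)
    (h : hom Y Z) :
  chain_post h (chain_pre b c) = chain_pre b (chain_post h c).
Proof. by case: n c => [c|n [E [g d]]] //=; rewrite compmA. Qed.

Lemma exact_at_epi_comp X N E Y (b : hom X N) (m : hom N E) (h : hom E Y) :
  epi b -> exact_at (m ∘ b) h <-> exact_at m h.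
Proof.
move=> eb; split=> [[I [i [[mi [e ee mbE]] ki]]] | [I [i [[mi [e ee mE]] ki]]]].
  have [|e' ie'] := kernel_lift (t := m) ki.
    apply: (epiP _).1 eb _ _ _; rewrite -compmA mbE compmA; case: ki => -> _.
    by rewrite comp0m.
  exists I, i; split=> //; split=> //; exists e' => //.
  apply: (@epi_left _ _ _ _ _ b); suff -> : e' ∘ b = e by [].
  by apply: mi; rewrite compmA ie' mbE.
exists I, i; split=> //; split=> //; exists (e ∘ b); first exact: epi_comp.
by rewrite mE compmA.
Qed.

Lemma exact_after_epi_comp n X N E Y (b : hom X N) (m : hom N E)
    (d : chain n E Y) :
  epi b -> exact_after (m ∘ b) d <-> exact_after m d.
Proof.
move=> eb; case: n d => [h|n [E' [h d]]] /=; split=> -[eh hd]; split=> //;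
  exact/(exact_at_epi_comp _ _ eb).
Qed.

(** As [g] is the kernel of [b], exactness of [g] followed by [m ∘ b] means that [m] is mono; beyond
    that, precomposing with the epi [b] does not change images. *)
Lemma exact_after_pre n T X N Y (g : hom T X) (b : hom X N) (d : chain n N Y) :
  ses g b -> exact_after g (chain_pre b d) <-> exact_chain d.
Proof.
move=> s.
suff H Z (m : hom N Z) : exact_at g (m ∘ b) <-> mono m.
  case: n d => [d|n [E [m d]]] /=.
    split=> [[/H mm /epi_left eb]|[mm ed]]; first by split.
    by split; [apply/H | apply: epi_comp ed (ses_epi s)].
  by rewrite H (exact_after_epi_comp _ _ (ses_epi s)).
split=> [[I [i [[mi [e ee gE]] ki]]]|mm].
  apply/monoP => U t mt0.
  have [U' [c [t' [ec bt']]]] := epi_cover t (ses_epi s).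
  have [|r ir] := kernel_lift (t := t') ki.
    by rewrite -compmA bt' compmA mt0 comp0m.
  have [U'' [c' [r' [ec' er']]]] := epi_cover r ee.
  apply: (epiP _).1 (epi_comp ec ec') _ _ _.
  by rewrite compmA -bt' -ir -!compmA -er' (compmA i) -gE compmA (ses0 s) comp0m.
exists T, g; split.
  split; first exact: ses_mono s.
  by exists (idm T); [apply: epi_id | rewrite compm1].
apply: kernelP; first by rewrite -compmA (ses0 s) compm0.
  exact: ses_mono s.
by move=> U t; rewrite -compmA => /((monoP _).1 mm)/(ses_lift s).
Qed.

(** The cut is at the cokernel [b] of [g]: the next morphism kills [g], hence factors through [b].
    Inductions on chains thus become inductions on short exact sequences. *)
Lemma exact_chain_cons n K E Y (g : hom K E) (d : chain n E Y) :
  @exact_chain C n.+1 K Y (existT _ E (g, d)) <->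
  exists N (b : hom E N) (d' : chain n N Y),
    [/\ ses g b, d = chain_pre b d' & exact_chain d'].
Proof.
split=> [[mg gd]|[N [b [d' [s -> ed']]]]]; last first.
  by split; [apply: ses_mono s | apply/(exact_after_pre _ s)].
have [N [b cb]] := cokernel_ex g; have s := cokernel_ses mg cb.
suff [d' dE] : exists d', d = chain_pre b d'.
  by exists N, b, d'; split=> //; apply/(exact_after_pre _ s); rewrite -dE.
have fact E' (h : hom E E') : exact_at g h -> exists h', h' ∘ b = h.
  move=> [I [i [[_ [e _ gE]] [hi _]]]]; apply: (cokernel_lift cb).
  by rewrite gE compmA hi comp0m.
case: n d gd => [h [/fact[h' <-] _]|n [E' [h d]] [/fact[h' <-] _]].
  by exists h'.
by exists (existT _ E' (h', d)).
Qed.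

Lemma exact_chain0P K Y (c : chain 0 K Y) :
  exact_chain c <-> exists c', c' ∘ c = idm K /\ c ∘ c' = idm Y.
Proof.
split=> [[mc ec]|[c' [c'c cc']]]; first exact: mono_epi_iso.
split; first by apply: (@mono_right _ _ _ _ c'); rewrite c'c; apply: mono_id.
by apply: (@epi_left _ _ _ _ _ c'); rewrite cc'; apply: epi_id.
Qed.

Lemma exact_chain_rcons n X N E Y (c : chain n X N) (m : hom N E)
    (p : hom E Y) :
  exact_chain c -> ses m p -> exact_chain (chain_rcons (chain_post m c) p).
Proof.
elim: n X c => [|n IH] X c ec s.
  apply/exact_chain_cons; exists Y, p, (idm Y); split.
  - by case: ec => mc ec; apply: ses_iso_left.
  - by rewrite /= comp1m.
  by split; [apply: mono_id | apply: epi_id].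
case: c ec => [E' [g d]] /exact_chain_cons[N' [b [d' [gb -> ed']]]].
apply/exact_chain_cons; exists N', b, (chain_rcons (chain_post m d') p).
by split=> //; [rewrite -chain_rcons_pre -chain_post_pre | apply: IH].
Qed.

(** * Comparison of exact chains with cut sequences *)

Section Represent.
Variable Y : C.

(* [c] maps to [x] over [f] when their would-be classes satisfy
   f_* [c] = [x]. *)
Fixpoint chain_map k K' K (f : hom K' K) :
    chain k K' Y -> ext_seq Y k K -> Prop :=
  match k return chain k K' Y -> ext_seq Y k K -> Prop with
  | 0 => fun c x => x ∘ c = f
  | k'.+1 => fun c x => let: existT E (g, d) := c in
      exists e : hom E (st_mid x),
        e ∘ g = st_in x ∘ f /\ chain_map (st_out x ∘ e) d (st_tail x)
  end.

Lemma chain_map_pre k K' K N (f : hom N K) (b : hom K' N) (c : chain k N Y) x :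
  chain_map f c x -> chain_map (f ∘ b) (chain_pre b c) x.
Proof.
case: k c x => [c x <-|k [E [g d]] x [e [eg ed]]] /=; first by rewrite compmA.
by exists e; split=> //; rewrite !compmA eg.
Qed.

Lemma chain_map_pre_epi k K' K N (f : hom N K) (b : hom K' N)
    (c : chain k N Y) x :
  epi b -> chain_map (f ∘ b) (chain_pre b c) x -> chain_map f c x.
Proof.
move=> eb; case: k c x => [c x|k [E [g d]] x [e [eg ed]]] /=.
  by rewrite compmA => /eb.
by exists e; split=> //; apply: eb; rewrite -!compmA.
Qed.

Lemma chain_map_seq k K' K K'' (f : hom K' K) (g : hom K K'') c x x' :
  chain_map f c x -> seq_map g x x' -> @chain_map k _ _ (g ∘ f) c x'.
Proof.
elim: k K' K K'' f g c x x' => [|k IH] K' K K'' f g c x x' /=.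
  by move=> <- <-; rewrite compmA.
case: c => [E [h d]] [e [eh ed]] [e' [n [ea nb t]]]; exists (e' ∘ e); split.
  by rewrite -compmA eh !compmA ea.
by rewrite compmA -nb -compmA; apply: IH ed t.
Qed.

Lemma ladder_chain_map k K'' K' K (u : hom K'' K') (f : hom K' K)
    (c : chain k K'' Y) (c' : chain k K' Y) x :
  ladder u (idm Y) c c' -> chain_map f c' x -> chain_map (f ∘ u) c x.
Proof.
elim: k K'' K' K u f c c' x => [|k IH] K'' K' K u f c c' x /=.
  by rewrite comp1m => -> <-; rewrite compmA.
case: c c' => [E [g d]] [E' [g' d']] [w [wg l]] [e [eg ed]].
exists (e ∘ w); split; first by rewrite -compmA wg !compmA eg.
by rewrite compmA; apply: IH l ed.
Qed.

Lemma ladder_pre k K' K N (b : hom K N) (e : hom K' K) (d' : chain k K' Y)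
    (d : chain k N Y) :
  ladder (b ∘ e) (idm Y) d' d -> ladder e (idm Y) d' (chain_pre b d).
Proof.
case: k d' d => [d' d|k [E' [g' d']] [E [g d]]] /=; first by rewrite compmA.
by move=> [w [wg l]]; exists w; rewrite wg compmA.
Qed.

(** The chain is cut at successive cokernels, and the final morphism is the inverse of the last
    isomorphism. The last two clauses make [x] interchangeable with [c]. *)
Lemma exact_chain_seq k K (c : chain k K Y) : exact_chain c ->
  exists x, [/\ chain_map (idm K) c x,
    (forall K' (f : hom K K') x', chain_map f c x' -> seq_map f x x')
  & (forall K' (f : hom K' K) c', chain_map f c' x -> ladder f (idm Y) c' c)].
Proof.
elim: k K c => [|k IH] K c.
  move=> /exact_chain0P[x [xc cx]]; exists x; split=> //=.
    by move=> K' f x' <-; rewrite -compmA cx compm1.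
  by move=> K' f c' <-; rewrite comp1m compmA cx comp1m.
case: c => [E [g d]] /exact_chain_cons[N [b [d' [s -> /IH[x [x1 x2 x3]]]]]].
exists (SesThen s x); split=> /=.
- exists (idm E); rewrite comp1m compm1; split=> //.
  by have := chain_map_pre b x1; rewrite comp1m compm1.
- move=> K' f x' [e [eg ed]].
  have [|n nb] := ses_colift (t := st_out x' ∘ e) s.
    by rewrite -compmA eg compmA (ses0 (st_ses x')) comp0m.
  exists e, n; split=> //; apply: x2; move: ed; rewrite -nb.
  exact: chain_map_pre_epi (ses_epi s).
move=> K' f [E' [g' d'']] [e [eg ed]]; exists e; split=> //.
by apply: ladder_pre; apply: x3.
Qed.

Lemma ladder_pre_source k K' K N (n : hom N K) (b : hom K' N) (d' : chain k N Y)
    (d : chain k K Y) :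
  ladder n (idm Y) d' d -> ladder (n ∘ b) (idm Y) (chain_pre b d') d.
Proof.
case: k d' d => [d' d|k [E' [g' d']] [E [g d]]] /=.
  by rewrite !compmA => ->.
by move=> [w [wg l]]; exists w; rewrite !compmA wg.
Qed.

(** The last short exact sequence is pulled back along the morphism from [Y], and the others are
    spliced in front of it; positive length provides a sequence to pull back. *)
Lemma seq_exact_chain k K (x : ext_seq Y k.+1 K) :
  exists c, [/\ exact_chain c, chain_map (idm K) c x
  & (forall K' (f : hom K' K) c', exact_chain c' -> chain_map f c' x ->
       ladder f (idm Y) c' c)].
Proof.
elim: k K x => [|k IH] K [E N a b s x].
  have [E' [a' [b' [e [s' ea [sq jm univ]]]]]] := ses_pullback x s.
  exists (existT _ E' (a', b')); split.
  - by apply/exact_chain_cons; exists Y, b', (idm Y); split=> //;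
      [rewrite /= comp1m | split; [apply: mono_id | apply: epi_id]].
  - by exists e; rewrite compm1.
  move=> K' f [E'' [g d]] /exact_chain_cons[N'' [b'' [d'' [s'' dE _]]]].
  move=> [e'' [eg ed]]; have [u [u1 u2]] := univ _ e'' d (esym ed).
  exists u; split; last by rewrite /= comp1m.
  apply: jm; first by rewrite !compmA u1 ea.
  rewrite !compmA u2 (ses0 s') comp0m dE -compmA (ses0 s'') compm0 //.
have [d [ed xd univ]] := IH _ x.
exists (existT _ E (a, chain_pre b d)); split.
- by apply/exact_chain_cons; exists N, b, d.
- exists (idm E); rewrite comp1m compm1; split=> //.
  by have := chain_map_pre b xd; rewrite comp1m compm1.
move=> K' f [E'' [g d0]] /exact_chain_cons[N'' [b'' [d'' [s'' -> ed'']]]].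
move=> [e'' [eg e''d]].
have [|n nb] := ses_colift (t := b ∘ e'') s''.
  by rewrite -compmA eg compmA (ses0 s) comp0m.
exists e''; split=> //; apply: ladder_pre; rewrite -nb.
apply: ladder_pre_source; apply: univ => //.
by apply: chain_map_pre_epi (ses_epi s'') _; rewrite nb.
Qed.

End Represent.

Lemma Ext_eq0P k Y Z :
  Ext_eq0 k Y Z <-> forall c d : extension k Y Z, yoneda_equiv c d.
Proof.
have yd c d : yoneda_equiv c d ->
    [set e | yoneda_equiv c e]%classic = [set e | yoneda_equiv d e]%classic.
  move=> cd; apply/seteqP; split=> e /= h; last exact: rst_trans cd h.
  by apply: rst_trans (rst_sym _ _ _ _ cd) h.
split=> [E0 c d|cd _ _ [c _ <-] [d _ <-]]; last exact/yd.
have e : [set e | yoneda_equiv c e]%classic = [set e | yoneda_equiv d e]%classic.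
  by apply: E0; [exists c | exists d].
have : [set e | yoneda_equiv d e]%classic d by apply: rst_refl.
by rewrite -e.
Qed.

(** At each ladder both sequences receive a map from the one cut out of the source chain, so
    [null_seq_map] applies. An equivalence is proved because zigzags run both ways. *)
Lemma exact_chain_null k Y Z (c c' : extension k.+1 Y Z)
    (x x' : ext_seq Y k.+1 Z) :
  yoneda_equiv c c' -> chain_map (idm Z) (sval c) x ->
  chain_map (idm Z) (sval c') x' -> null_seq x -> null_seq x'.
Proof.
suff: yoneda_equiv c c' -> forall x x', chain_map (idm Z) (sval c) x ->
  chain_map (idm Z) (sval c') x' -> (null_seq x <-> null_seq x').
  by move=> h /h{}h cx cx'; apply: (h _ _ cx cx').1.
elim=> {x x' c c'} [c d l|c|c d _ IH|c d e _ IH1 _ IH2] x x'.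
- move=> cx dx'; have [y [_ cu _]] := exact_chain_seq (svalP c).
  rewrite -(null_seq_map (cu _ _ _ cx)).
  by have := ladder_chain_map l dx'; rewrite comp1m => /cu/null_seq_map.
- move=> cx cx'; have [y [_ cu _]] := exact_chain_seq (svalP c).
  by rewrite -(null_seq_map (cu _ _ _ cx)) (null_seq_map (cu _ _ _ cx')).
- by move=> dx cx'; rewrite (IH _ _ cx' dx).
move=> cx ex'; have [y [dy _ _]] := exact_chain_seq (svalP d).
by rewrite (IH1 _ _ cx dy) (IH2 _ _ dy ex').
Qed.

Lemma Ext_eq0_vanish k Y Z : Ext_eq0 k.+1 Y Z <-> ext_vanish Y k Z.
Proof.
rewrite Ext_eq0P ext_vanishP; split=> [E0 x | V].
  have [c [ec cx _]] := seq_exact_chain x.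
  (* [x0] has the tail of [x] behind a split sequence. It is null through [i2]; all extensions being
     equivalent, [x] is null as well. *)
  have [S [i1 [i2 [p1 [p2 [[e1 e2 e3 e4 e5] s]]]]]] :=
    ses_biproduct Z (st_quo x).
  pose x0 : ext_seq Y k.+1 Z := SesThen s (st_tail x).
  have [c0 [ec0 cx0 _]] := seq_exact_chain x0.
  apply: (exact_chain_null (E0 (exist _ c0 ec0) (exist _ c ec)) cx0 cx).
  have [y [xy /(_ _ p2)h]] := seq_push i2 (st_tail x).
  by exists y; apply: h; rewrite /= e2; apply: seq_map_id.
have [O O0] := zero_object_ex C; have [y0 y0E] := seq_terminal Y k O0.
have s0 : ses (idm Z) (0 : hom Z O).
  by apply: (@ses_zero_target _ _ _ _ _ _ (idm Z)); rewrite ?comp1m.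
have [c0 [ec0 _ cu0]] := seq_exact_chain (SesThen s0 y0 : ext_seq Y k.+1 Z).
pose d0 : extension k.+1 Y Z := exist _ c0 ec0.
suff H (c : extension k.+1 Y Z) : yoneda_equiv c d0.
  by move=> c d; apply: rst_trans (H c) (rst_sym _ _ _ _ (H d)).
have [x [cx _ cu]] := exact_chain_seq (svalP c); have [y yx] := V x.
(* The witness [y], placed behind the split sequence on [Z] and the middle term of [x], gives an
   extension with ladders both to [c] and to the trivial extension [d0]. *)
have [S [i1 [i2 [p1 [p2 [[e1 e2 e3 e4 e5] s]]]]]] := ses_biproduct Z (st_mid x).
have [h [eh hx hu]] := seq_exact_chain (SesThen s y : ext_seq Y k.+1 Z).
apply: (@rst_trans _ _ _ (exist _ h eh)).
  apply/rst_sym/rst_step; apply: cu; rewrite -(comp1m (idm Z)).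
  apply: (chain_map_seq hx); exists (st_in x ∘ p1 + p2), (st_out x).
  split=> //=; first by rewrite compmDl -compmA e1 e4 addr0.
  by rewrite compmDr !compmA (ses0 (st_ses x)) comp0m add0r.
apply: rst_step; apply: cu0 => //.
have {}hx o e g := chain_map_seq (g := g) (x' := e : ext_seq Y k.+1 o) hx.
have := hx Z (SesThen s0 y0) (idm Z); rewrite comp1m; apply.
exists p1, 0; split=> //=; first by rewrite e1 comp1m.
by rewrite !comp0m.
Qed.

End Chains.

(** * Opposite category, long exact sequences, resolutions *)

Section Reversal.
Local Open Scope ring_scope.
Local Open Scope cat_scope.

Lemma ladder_rcons (C : abelianCategory) n (X Y Z X' Y' Z' : C) (u : hom X X')
    (w : hom Z Z') (c : chain n X Y) (h : hom Y Z) (d : chain n X' Y')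
    (h' : hom Y' Z') :
  ladder u w (chain_rcons c h) (chain_rcons d h') <->
  exists v, ladder u v c d /\ w ∘ h = h' ∘ v.
Proof.
elim: n X X' u c d => [|n IH] X X' u c d /=.
  by split=> -[v [vc wh]]; exists v.
case: c d => [E [g c]] [E' [g' d]]; split.
  by move=> [e [eg /IH[v [l wh]]]]; exists v; split=> //; exists e.
by move=> [v [[e [eg l]] wh]]; exists e; split=> //; apply/IH; exists v.
Qed.

Lemma ladder_id (C : abelianCategory) n (X Y : C) (c : chain n X Y) :
  ladder (idm X) (idm Y) c c.
Proof.
elim: n X c => [|n IH] X c /=; first by rewrite comp1m compm1.
by case: c => [E [g c]]; exists (idm E); rewrite comp1m compm1.
Qed.

Variable C : abelianCategory.
Local Notation Cop := (opp_abelian C).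
Implicit Types X Y Z K E N : C.

Lemma opp_ses X Y Z (f : hom X Y) (g : hom Y Z) :
  @ses Cop Z Y X g f <-> ses f g.
Proof.
split=> [[cg mf]|fg]; first exact: (@cokernel_ses C X Y Z f g mf cg).
by split; [exact (ses_cokernel fg) | exact (ses_mono fg)].
Qed.

Fixpoint chain_rev n X Y (c : chain n X Y) : @chain Cop n Y X :=
  match n return chain n X Y -> @chain Cop n Y X with
  | 0 => fun c => c
  | n'.+1 => fun c => let: existT E (g, d) := c in
                      @chain_rcons Cop n' Y E X (chain_rev d) g
  end c.

Lemma chain_rev_rcons n X Y Z (c : chain n X Y) (h : hom Y Z) :
  chain_rev (chain_rcons c h) = existT _ Y (h, chain_rev c).
Proof.
elim: n X c => [|n IH] X c //; case: c => [E [g c]].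
by rewrite -[LHS]/(@chain_rcons Cop _ _ _ _ (chain_rev (chain_rcons c h)) g) IH.
Qed.

Lemma chain_rev_post n X Y Z (c : chain n X Y) (h : hom Y Z) :
  chain_rev (chain_post h c) = @chain_pre Cop n Z Y X h (chain_rev c).
Proof.
elim: n X c => [|n IH] X c //=; case: c => [E [g c]] /=.
by rewrite IH (@chain_rcons_pre Cop).
Qed.

Lemma chain_rev_pre n K X Y (b : hom K X) (c : chain n X Y) :
  chain_rev (chain_pre b c) = @chain_post Cop n Y X K b (chain_rev c).
Proof.
case: n c => [|n] c //=; case: c => [E [g c]] /=.
elim: n Y {c}(chain_rev c) => [|n IH] Y c //=.
by case: c => [E' [g' c]] /=; rewrite IH.
Qed.

Lemma exact_chain_rev n X Y (c : chain n X Y) :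
  exact_chain c -> exact_chain (chain_rev c).
Proof.
elim: n X c => [|n IH] X c; first by move=> [mc ec]; split; [exact ec|exact mc].
case: c => [E [g d]] /exact_chain_cons[N [b [d' [/opp_ses s -> /IH ed']]]].
rewrite /= chain_rev_pre.
exact: (@exact_chain_rcons Cop n Y N E X (chain_rev d') b g ed' s).
Qed.

(** Surjectivity stands in for involutivity of the reversal, which would involve the opposite of the
    opposite category. *)
Lemma exact_chain_rev_surj n X Y (c' : @chain Cop n Y X) :
  exact_chain c' -> exists2 c : chain n X Y, exact_chain c & chain_rev c = c'.
Proof.
elim: n Y c' => [|n IH] Y c'.
  by move=> [mc ec]; exists c'.
case: c' => [E [g d]].
move=> /(@exact_chain_cons Cop)[N [b [_ [/opp_ses s -> /IH[d' ed' <-]]]]].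
exists (@chain_rcons C n X E Y (@chain_post C n X N E b d') g).
  exact: exact_chain_rcons ed' s.
by rewrite chain_rev_rcons chain_rev_post.
Qed.

Lemma ladder_rev n X Y X' Y' (u : hom X X') (v : hom Y Y') (c : chain n X Y)
    (d : chain n X' Y') :
  @ladder Cop n Y' X' Y X v u (chain_rev d) (chain_rev c) <-> ladder u v c d.
Proof.
elim: n X X' u c d => [|n IH] X X' u c d /=.
  by split=> /esym.
case: c d => [E [g c]] [E' [g' d]]; split.
  by move=> /(@ladder_rcons Cop)[w [/IH l wg]]; exists w.
by move=> [w [wg /IH l]]; apply/(@ladder_rcons Cop); exists w.
Qed.

(** Reversal flips the direction of ladders, which the symmetric closure absorbs. *)
Lemma Ext_eq0_opp k Y Z : @Ext_eq0 Cop k Z Y <-> Ext_eq0 k Y Z.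
Proof.
rewrite !Ext_eq0P; split=> H c d.
  have revK (e : extension k Y Z) :
    {e' : @extension Cop k Z Y | sval e' = chain_rev (sval e)}.
    by exists (exist _ _ (exact_chain_rev (svalP e))).
  have [c' c'E] := revK c; have [d' d'E] := revK d.
  have := H c' d'; move=> h; elim: h c c'E d d'E
    => {H c' d'} [c' d' l|c'|c' d' _ IH|c' e' d' _ IH1 _ IH2] c c'E d d'E.
  - apply/rst_sym/rst_step/ladder_rev; rewrite -c'E -d'E; exact: l.
  (* Here [c] and [d] have the same reversal; the identity ladder links them without appeal to
     injectivity of [chain_rev]. *)
  - by apply/rst_sym/rst_step/ladder_rev; rewrite -c'E -d'E; apply: ladder_id.
  - by apply: rst_sym; apply: IH.
  have [e ee eE] := exact_chain_rev_surj (svalP e').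
  by apply: rst_trans (IH1 _ c'E (exist _ e ee) _) (IH2 _ _ _ d'E).
have [c1 ec1 c1E] := exact_chain_rev_surj (svalP c).
have [d1 ed1 d1E] := exact_chain_rev_surj (svalP d).
have := H (exist _ c1 ec1) (exist _ d1 ed1).
move: c d c1E d1E; set c2 := exist _ _ _; set d2 := exist _ _ _.
rewrite -[c1]/(sval c2) -[d1]/(sval d2).
move: c2 d2 => {c1 ec1 d1 ed1 H} c2 d2 c d cE dE h; elim: h c cE d dE
  => {c2 d2} [c' d' l|c'|c' d' _ IH|c' e' d' _ IH1 _ IH2] c cE d dE.
- apply/rst_sym/rst_step; rewrite /extension_morphism -cE -dE.
  exact/ladder_rev.
- by apply/rst_step; rewrite /extension_morphism -cE -dE; apply: ladder_id.
- by apply: rst_sym; apply: IH.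
pose e := exist _ _ (exact_chain_rev (svalP e')) : @extension Cop k Z Y.
by apply: rst_trans (IH1 _ cE e _) (IH2 _ _ _ dE).
Qed.

End Reversal.

(** * Dimension shifting in the second argument of Ext *)

Section LongExactSequences.
Local Open Scope cat_scope.
Variable C : abelianCategory.
Implicit Types Y Z K E M : C.

Lemma Ext_eq0_target k Y Z' Z Z'' (f : hom Z' Z) (g : hom Z Z'') :
  ses f g -> Ext_eq0 k.+1 Y Z -> Ext_eq0 k.+2 Y Z' -> Ext_eq0 k.+1 Y Z''.
Proof. by rewrite !Ext_eq0_vanish; apply: ext_vanish_target. Qed.

(** In length [0] the cut sequences are morphisms from [Y], so the vanishing lifts the identity of
    [Y]. *)
Lemma Ext_eq0_split Y Z E (f : hom Z E) (g : hom E Y) :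
  ses f g -> Ext_eq0 1 Y Z -> exists s, g ∘ s = idm Y.
Proof. by move=> fg /Ext_eq0_vanish V; apply: (V _ _ _ _ fg (idm Y)). Qed.

End LongExactSequences.

(** * Dimension shifting in the first argument of Ext, by duality *)

Section LongExactSequencesSource.
Variable C : abelianCategory.
Implicit Types Y Z K E M : C.

Lemma Ext_eq0_source_sub k Z K A M (f : hom K A) (g : hom A M) :
  ses f g -> Ext_eq0 k.+1 A Z -> Ext_eq0 k.+2 M Z -> Ext_eq0 k.+1 K Z.
Proof.
move=> /opp_ses fg /Ext_eq0_opp AZ /Ext_eq0_opp MZ.
by apply/Ext_eq0_opp; apply: Ext_eq0_target fg AZ MZ.
Qed.

Lemma Ext_eq0_source_quo k Z K A M (f : hom K A) (g : hom A M) :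
  ses f g -> Ext_eq0 k.+1 K Z -> Ext_eq0 k.+2 A Z -> Ext_eq0 k.+2 M Z.
Proof.
move=> /opp_ses fg /Ext_eq0_opp/Ext_eq0_vanish KZ /Ext_eq0_opp/Ext_eq0_vanish AZ.
by apply/Ext_eq0_opp/Ext_eq0_vanish; apply: ext_vanish_source fg KZ AZ.
Qed.

End LongExactSequencesSource.

(** * Relative resolutions and coresolutions as iterated short exact sequences *)

Section Resolutions.
Local Open Scope ring_scope.
Local Open Scope cat_scope.
Local Open Scope classical_set_scope.
Variable C : abelianCategory.
Implicit Types X Y Z K E N M L : C.

Definition iso_closed (D : set C) : Prop :=
  forall X Y (f : hom X Y) (g : hom Y X),
    g ∘ f = idm X -> f ∘ g = idm Y -> D X -> D Y.

(** The isomorphism exhibits [X] as a biproduct of [Y] and a zero object. *)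
Lemma summand_iso_closed (D : set C) : summand_closed D -> iso_closed D.
Proof.
move=> sD X Y f g gf fg; have [O O0] := zero_object_ex C; apply: (sD Y O X).
exists g, 0, f, 0; split=> //; rewrite ?comp0m ?compm0 ?addr0 //.
exact: is_zero_object_to.
Qed.

Lemma split_summand (D : set C) Z E Y (f : hom Z E) (g : hom E Y)
    (s : hom Y E) :
  summand_closed D -> ses f g -> g ∘ s = idm Y -> D E -> D Y.
Proof.
move=> sD fg gs; apply: (sD Y Z E).
have [|r rE] := ses_lift (t := idm E - s ∘ g) fg.
  by rewrite compmB compmA gs compm1 comp1m subrr.
have mf := ses_mono fg.
exists s, f, g, r; split=> //; last by rewrite rE addrC subrK.
- apply: mf; rewrite compmA rE compBm -compmA (ses0 fg) compm0.
  by rewrite comp1m compm1 subr0.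
- exact: ses0 fg.
by apply: mf; rewrite compmA rE compBm -compmA gs comp1m compm1 subrr compm0.
Qed.

Variables (Q P : set C).

(** Chains cut at images. For [n' = 0] the object [N] is isomorphic to [M], the image of the last
    morphism, which is under no condition; hence the guard. *)
Fixpoint linked n L M : Prop :=
  match n with
  | 0 => exists (f : hom L M) (g : hom M L), g ∘ f = idm L /\ f ∘ g = idm M
  | n'.+1 => exists E N (a : hom L E) (b : hom E N),
      [/\ ses a b, Q E, (0 < n')%N -> P N & linked n' N M]
  end.

Fixpoint resolved n M : Prop :=
  match n with
  | 0 => P M /\ Q M
  | n'.+1 => exists K E (a : hom K E) (b : hom E M),
      [/\ ses a b, Q E, P K & resolved n' K]
  end.

Fixpoint coresolved n M : Prop :=
  match n with
  | 0 => P M /\ Q M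
  | n'.+1 => exists E N (a : hom M E) (b : hom E N),
      [/\ ses a b, Q E, P N & coresolved n' N]
  end.

Hypothesis Piso : iso_closed P.
Hypothesis Qiso : iso_closed Q.

Lemma image_in_mono_epi E N E' (b : hom E N) (m : hom N E') :
  epi b -> mono m -> image_in P (m ∘ b) <-> P N.
Proof.
move=> eb mm; split=> [[I [i [[mi [e ee mbE]] PI]]]|PN]; last first.
  by exists N, m; split=> //; split=> //; exists b.
have [K [k kk]] := kernel_ex b; have s : ses k b by split.
have [|h hb] := ses_colift (t := e) s.
  by apply: mi; rewrite compmA -mbE -compmA (ses0 s) !compm0.
have ih : i ∘ h = m by apply: eb; rewrite -compmA hb.
have [||h' [h'h hh']] := mono_epi_iso (f := h).
- by apply: (@mono_right _ _ _ _ i); rewrite ih.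
- by apply: (@epi_left _ _ _ _ _ b); rewrite hb.
exact: Piso hh' h'h PI.
Qed.

Lemma linkedP n L M : linked n L M <->
  exists c : chain n L M,
    [/\ exact_chain c, middle_in Q c & inner_images_in P c].
Proof.
elim: n L => [|n IH] L.
  split=> [[f [g fg]]|[c [/exact_chain0P[g fg] _ _]]]; last by exists c, g.
  by exists f; split=> //; apply/exact_chain0P; exists g.
have mid E N (b : hom E N) (d : chain n N M) :
  middle_in Q (chain_pre b d) <-> middle_in Q d.
  by case: (n) d => [|n'] d //; case: d => [E' [m d]].
have inn E N (b : hom E N) (d : chain n N M) : epi b -> exact_chain d ->
  images_but_last_in P (chain_pre b d) <->
  ((0 < n)%N -> P N) /\ inner_images_in P d.
  move=> eb; case: (n) d => [|n'] d; first by split=> // _; split.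
  case: d => [E' [m d]] [mm _]; rewrite /= (image_in_mono_epi eb mm).
  by split=> -[PN ?]; split=> //; apply: PN.
split=> [[E [N [a [b [s QE PN /IH[d [ed md id]]]]]]]|[[E [g d0]] []]].
  exists (existT _ E (a, chain_pre b d)); split.
  - by apply/exact_chain_cons; exists N, b, d.
  - by split=> //; apply/mid.
  by apply/(inn _ _ _ _ (ses_epi s) ed).
move=> /exact_chain_cons[N [b [d [s -> ed]]]] [QE /mid md].
move=> /(inn _ _ _ _ (ses_epi s) ed)[PN id].
by exists E, N, g, b; split=> //; apply/IH; exists d.
Qed.

(** [linked] unfolds next to [L], which suits coresolutions; resolutions have to be unfolded next to
    [M]. *)
Lemma linked_rcons n L M : linked n.+1 L M <->
  exists K E (a : hom K E) (b : hom E M),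
    [/\ ses a b, Q E, (0 < n)%N -> P K & linked n L K].
Proof.
have iso_P N K : linked 0 N K -> (P N <-> P K).
  by move=> [f [g [gf fg]]]; split; [apply: Piso gf fg | apply: Piso fg gf].
have iso_me (X Y : C) (f : hom X Y) g : g ∘ f = idm X -> f ∘ g = idm Y ->
    mono f /\ epi f.
  by move=> gf fg; apply/exact_chain0P; exists g.
elim: n L => [|n IH] L.
  split=> [[E [N [a [b [s QE _ [f [g [gf fg]]]]]]]]|].
    exists L, E, a, (f ∘ b); split=> //; last first.
      by exists (idm L), (idm L); rewrite comp1m.
    by have [mf ef] := iso_me _ _ _ _ gf fg; apply: ses_iso_right.
  move=> [K [E [a [b [s QE _ [f [g [gf fg]]]]]]]].
  exists E, M, (a ∘ f), b; split=> //; last first.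
    by exists (idm M), (idm M); rewrite comp1m.
  by have [mf ef] := iso_me _ _ _ _ gf fg; apply: ses_iso_left.
split=> [[E [N [a [b [s QE PN]]]]]|].
  move=> /IH[K [E' [a' [b' [s' QE' PK NK]]]]].
  exists K, E', a', b'; split=> //; last first.
    by exists E, N, a, b; split=> // _; apply: PN.
  (* For [n = 0] the guard on [K] is void, but [K] is then isomorphic to [N], which is in [P]. *)
  by case: (n) PK NK => [_ /iso_P[+ _] _|n' PK _ _]; [apply; apply: PN | apply: PK].
move=> [K [E [a [b [s QE PK [E' [N [a' [b' [s' QE' PN NK]]]]]]]]]].
exists E', N, a', b'; split=> //.
  by case: (n) PN NK => [_ /iso_P[_ +] _|n' PN _ _]; [apply; apply: PK | apply: PN].
by apply/IH; exists K, E, a, b; split=> // _; apply: PK.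
Qed.

Lemma has_coresolutionP n M : has_coresolution Q P n M <-> coresolved n M.
Proof.
have -> : has_coresolution Q P n M <-> exists2 L, (P `&` Q) L & linked n M L.
  split=> [[L [c [ec PQ mc ic]]]|[L PQ /linkedP[c [ec mc ic]]]].
    by exists L => //; apply/linkedP; exists c.
  by exists L, c.
elim: n M => [|n IH] M.
  split=> [[L [PL QL] [f [g [gf fg]]]]|PQ].
    by split; [apply: Piso fg gf PL | apply: Qiso fg gf QL].
  by exists M => //; exists (idm M), (idm M); rewrite comp1m.
split=> [[L PQ [E [N [a [b [s QE PN NL]]]]]]|].
  have cN : coresolved n N by apply/IH; exists L.
  exists E, N, a, b; split=> //.
  (* For [n = 0] the guard gives nothing, but [N] is then the last term, which is in [P]. *)
  by case: (n) PN cN => [_ []|n' PN _] //; apply: PN.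
move=> [E [N [a [b [s QE PN /IH[L PQ NL]]]]]]; exists L => //.
by exists E, N, a, b.
Qed.

Lemma has_resolutionP n M : has_resolution Q P n M <-> resolved n M.
Proof.
have -> : has_resolution Q P n M <-> exists2 L, (P `&` Q) L & linked n L M.
  split=> [[L [c [ec PQ mc ic]]]|[L PQ /linkedP[c [ec mc ic]]]].
    by exists L => //; apply/linkedP; exists c.
  by exists L, c.
elim: n M => [|n IH] M.
  split=> [[L [PL QL] [f [g [gf fg]]]]|PQ].
    by split; [apply: Piso gf fg PL | apply: Qiso gf fg QL].
  by exists M => //; exists (idm M), (idm M); rewrite comp1m.
split=> [[L PQ /linked_rcons[K [E [a [b [s QE PK LK]]]]]]|].
  have rK : resolved n K by apply/IH; exists L.
  exists K, E, a, b; split=> //.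
  by case: (n) PK rK => [_ []|n' PK _] //; apply: PK.
move=> [K [E [a [b [s QE PK /IH[L PQ LK]]]]]]; exists L => //.
by apply/linked_rcons; exists K, E, a, b.
Qed.

End Resolutions.

Lemma resolved_opp (C : abelianCategory) (Q P : set C) n (M : C) :
  @resolved (opp_abelian C) Q P n M <-> coresolved Q P n M.
Proof.
elim: n M => [|n IH] M //=; split.
  by move=> [N [E [b [a [/opp_ses s QE PN /IH r]]]]]; exists E, N, a, b.
by move=> [E [N [a [b [/opp_ses s QE PN /IH r]]]]]; exists N, E, b, a.
Qed.

(** * Homological dimensions *)

(** Dimensions are compared bound by bound, which also settles the infinite case; resolutions are
    then needed in every length that bounds the dimension. *)
Lemma emin_ext (P Q : nat -> Prop) : (forall n, P n <-> Q n) -> emin P = emin Q.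
Proof. by move=> PQ; congr emin; apply/funext => n; apply/propext. Qed.

Lemma emin_eq0 (P : nat -> Prop) : emin P = Some 0%N <-> P 0%N.
Proof.
rewrite /emin; case: pselect => [ex|nex].
  case: ex_minnP => m /asboolP Pm mP; split=> [[<-]|P0] //.
  by congr Some; apply/eqP; rewrite -leqn0; apply/mP/asboolP.
by split=> // P0; case: nex; exists 0%N; apply/asboolP.
Qed.

Lemma esup_eq0 (S : set enat) :
  esup S = Some 0%N <-> forall x, S x -> x = Some 0%N.
Proof.
rewrite emin_eq0; split=> S0 x /S0; last by move=> ->.
by case: x => //= m; rewrite leqn0 => /eqP ->.
Qed.

Section Dimensions.
Local Open Scope classical_set_scope.
Local Open Scope cat_scope.
Variable C : abelianCategory.
Implicit Types X Y Z K E N M L : C.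
Implicit Types D Q P W : set C.

Definition pd_le D n M : Prop :=
  forall Z, D Z -> forall k, (n < k)%N -> Ext_eq0 k M Z.

Lemma pd_class_eq0 D W : pd_class D W = Some 0%N <->
  forall Y Z k, W Y -> D Z -> Ext_eq0 k.+1 Y Z.
Proof.
rewrite esup_eq0; split=> [H Y Z k WY DZ | H _ [Y WY <-]].
  by have /emin_eq0 := H _ (ex_intro2 _ _ Y WY erefl); apply.
by apply/emin_eq0 => Z DZ [|k] // _; apply: H.
Qed.

Lemma id_class_eq0 D W : id_class D W = Some 0%N <->
  forall Y Z k, W Y -> D Z -> Ext_eq0 k.+1 Z Y.
Proof.
rewrite esup_eq0; split=> [H Y Z k WY DZ | H _ [Y WY <-]].
  by have /emin_eq0 := H _ (ex_intro2 _ _ Y WY erefl); apply.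
by apply/emin_eq0 => Z DZ [|k] // _; apply: H.
Qed.

Lemma pd_le_subset D D' n M : D `<=` D' -> pd_le D' n M -> pd_le D n M.
Proof. by move=> DD' H Z /DD'; apply: H. Qed.

(** Each step raises the bound by one: Ext^(k+2)(M, Z) lies between Ext^(k+1)(K, Z) and Ext^(k+2)(E,
    Z), which both vanish. *)
Lemma pd_le_resolved D Q P n M :
  (forall E, Q E -> pd_le D 0 E) -> resolved Q P n M -> pd_le D n M.
Proof.
move=> QD; elim: n M => [M [_ /QD]//|n IH M].
move=> [K [E [a [b [s QE _ /IH rK]]]]] Z DZ [|[|k]] // nk.
by apply: (Ext_eq0_source_quo s); [apply: rK | apply: QD].
Qed.

Lemma pd_le_syzygy D n K E M (a : hom K E) (b : hom E M) :
  ses a b -> pd_le D 0 E -> pd_le D n.+1 M -> pd_le D n K.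
Proof.
move=> s E0 Mn Z DZ [|k] // nk.
by apply: (Ext_eq0_source_sub s); [apply: E0 | apply: Mn].
Qed.

(* Descending induction on the degree, starting above the bound m. *)
Lemma pd_le_generator D W m n M :
  rel_generator W D -> pd_le D m M -> pd_le W n M -> pd_le D n M.
Proof.
move=> [_ gen] Mm Mn Z DZ k nk.
have [j] : exists j, (m < k + j)%N by exists m.+1; rewrite addnS ltnS leq_addl.
elim: j k Z DZ nk => [|j IH] k Z DZ nk mk.
  by apply: Mm => //; rewrite addn0 in mk.
have [E [Z' [f [g [/short_exactP s WE DZ']]]]] := gen Z DZ.
case: k nk mk => [|k] // nk mk.
(* Ext^(k+1)(M, Z) lies between Ext^(k+1)(M, E), zero as [E] is in [W], and Ext^(k+2)(M, Z'), zero
   by induction. *)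
apply: (Ext_eq0_target s); first exact: Mn.
by apply: IH => //; [apply: ltnW | rewrite addSnnS].
Qed.

Lemma resolved_image Q P P' n M :
  P `<=` P' -> resolved Q P n M -> resolved Q P' n M.
Proof.
move=> PP'; elim: n M => [M [/PP' PM QM]|n IH M] //.
by move=> [K [E [a [b [s QE /PP' PK /IH rK]]]]]; exists K, E, a, b.
Qed.

Lemma iso_closedT : iso_closed (setT : set C).
Proof. by []. Qed.

Lemma pd_le_wedge W n M : iso_closed W ->
  pd_le W n M <-> pd_le (wedge W setT) n M.
Proof.
move=> Wiso; split=> [Mn Z [m /(has_resolutionP iso_closedT Wiso)]|].
  elim: m Z => [|m IH] Z [].
    by move=> _ WZ; apply: Mn.
  move=> K [E [a [b [s WE _ /IH rK]]]] [|k] // nk.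
  by apply: (Ext_eq0_target s); [apply: Mn | apply/rK/ltnW].
apply: pd_le_subset => E WE; exists 0%N.
exact/(has_resolutionP iso_closedT Wiso).
Qed.

Lemma summand_closedI D D' :
  summand_closed D -> summand_closed D' -> summand_closed (D `&` D').
Proof. by move=> sD sD' X Y S XYS [/(sD _ _ _ XYS) ? /(sD' _ _ _ XYS) ?]. Qed.

Lemma summand_closed_zero D M O :
  summand_closed D -> is_zero_object O -> D M -> D O.
Proof.
move=> sD O0; apply: (sD O M M).
exists 0%R, (idm M), 0%R, (idm M).
split; rewrite ?comp0m ?compm0 ?comp1m ?GRing.add0r //;
  by [apply: is_zero_object_to | apply: is_zero_object_from].
Qed.

(** A zero object is added at the far end. Lengths being exact, this is how a short resolution
    reaches a larger bound. *)
Lemma resolved_pad Q P n M : summand_closed Q -> summand_closed P ->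
  resolved Q P n M -> resolved Q P n.+1 M.
Proof.
move=> sQ sP; have [O O0] := zero_object_ex C.
elim: n M => [M [PM QM]|n IH M].
  exists O, M, 0%R, (idm M); split=> //.
  - by apply: (@ses_zero_source _ _ _ _ _ _ (idm M)); rewrite ?comp1m.
  - exact: summand_closed_zero PM.
  by split; [apply: summand_closed_zero PM|apply: summand_closed_zero QM].
by move=> [K [E [a [b [s QE PK /IH rK]]]]]; exists K, E, a, b.
Qed.

(** * Dimensions relative to a left complete hereditary pair *)

Section Pair.
Variables X A B : set C.
Hypothesis ABleft : left_complete_pair X A B.
Hypothesis ABher : hereditary_pair X A B.
Hypothesis Xext : extension_closed X.
Hypothesis Asummand : summand_closed A.
Hypothesis Xsummand : summand_closed X.
Hypothesis Bsummand : summand_closed B.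
Local Notation omega := (A `&` B `&` X).
Hypothesis omega_gen : rel_generator omega (B `&` X).

Let omega_summand : summand_closed omega.
Proof.
exact: summand_closedI (summand_closedI Asummand Bsummand) Xsummand.
Qed.

Let pd_AX E : (A `&` X) E -> pd_le (B `&` X) 0 E.
Proof.
by move=> AE Z BZ [|k] // _; apply: (id_class_eq0 _ _).1 ABher _ _ _ BZ AE.
Qed.

Let pd_omega E : omega E -> pd_le (B `&` X) 0 E.
Proof. by move=> [[AE _] XE]; apply: pd_AX. Qed.

(** Each term [E] is an extension of [M] by the syzygy [K], both in [X]. *)
Lemma resolved_terms n M :
  X M -> resolved A X n M -> resolved (X `&` A) setT n M.
Proof.
elim: n M => [M XM [_ AM]|n IH M XM] //.
move=> [K [E [a [b [s AE XK rK]]]]]; exists K, E, a, b; split=> //.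
  by split=> //; move/short_exactP: s => s; apply: Xext s XK XM.
exact: IH.
Qed.

(** For [n = 0] the left approximation of [M] splits, its kernel being in [B ∩ X], and [M] is a
    summand of an object of [A]. Otherwise that kernel is a syzygy with bound [n]. *)
Lemma resolved_pd_le n M : X M -> pd_le (B `&` X) n M -> resolved A X n M.
Proof.
elim: n M => [|n IH] M XM Mn.
  have [E [F [f [g [/short_exactP s [AE _] BF]]]]] := ABleft XM.
  have [t gt] := Ext_eq0_split s (Mn _ BF 1%N isT).
  by split=> //; exact: split_summand Asummand s gt AE.
have [E [F [f [g [/short_exactP s [AE XE] [BF XF]]]]]] := ABleft XM.
exists F, E, f, g; split=> //; apply: IH => //.
by apply: pd_le_syzygy s _ Mn; apply: pd_AX.
Qed.

Lemma pd_le_resolvedP n M : X M -> pd_le (B `&` X) n M <-> resolved A X n M.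
Proof.
move=> XM; split; first exact: resolved_pd_le.
move=> /(resolved_terms XM); apply: pd_le_resolved => E [XE AE].
exact: pd_AX.
Qed.

(** The given resolution is followed until the bound reaches [0], where it splits, or until it ends,
    where it is padded. *)
Lemma resolved_omega_pd_le m n M : X M -> resolved omega X m M ->
  pd_le (B `&` X) n M -> resolved omega X n M.
Proof.
elim: n m M => [|n IH] [|m] M XM //.
- move=> [K [E [a [b [s WE XK rK]]]]] Mn; split=> //.
  have [|t bt] := Ext_eq0_split s; last exact: split_summand omega_summand s bt WE.
  have Wiso := summand_iso_closed omega_summand.
  (* The splitting needs Ext^1(M, K) = 0, and [K] has a finite resolution by objects of [omega]. *)
  suff : pd_le (wedge omega setT) 0 M.
    apply=> //; exists m; apply/(has_resolutionP iso_closedT Wiso).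
    exact: resolved_image rK.
  apply: (pd_le_wedge _ _ Wiso).1; apply: pd_le_subset Mn.
  by move=> ? [[]].
- by move=> rM _; elim: (n.+1) => // j /resolved_pad; apply.
move=> [K [E [a [b [s WE XK rK]]]]] Mn; exists K, E, a, b; split=> //.
by apply: (IH m) => //; apply: pd_le_syzygy s _ Mn; apply: pd_omega.
Qed.

Lemma pdim_resdim M : pair_wedge A X M ->
  [/\ pdim (B `&` X) M = pdim omega M,
      pdim omega M = pdim (wedge omega setT) M,
      pdim (wedge omega setT) M = resdim A X M
    & resdim A X M = resdim (X `&` A) setT M].
Proof.
have isoA := summand_iso_closed Asummand.
have isoX := summand_iso_closed Xsummand.
have isoXA := summand_iso_closed (summand_closedI Xsummand Asummand).
have Wiso := summand_iso_closed omega_summand.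
move=> [[m /(has_resolutionP isoX isoA) rm] XM].
have pdB n : pd_le (B `&` X) n M <-> pd_le omega n M.
  split; first by apply: pd_le_subset => ? [[]].
  (* The length [m] of the given resolution bounds the dimension over [B ∩ X] and starts the
     descending induction. *)
  by apply: (pd_le_generator (m := m)) => //; apply/pd_le_resolvedP.
have pdr n : pd_le (B `&` X) n M <-> has_resolution A X n M.
  by rewrite pd_le_resolvedP// has_resolutionP.
split; apply: emin_ext => n; first exact: pdB.
- exact: (pd_le_wedge _ _ Wiso).
- by rewrite -pdr pdB; apply: iff_sym; apply: pd_le_wedge.
(* Conversely, a resolution by [X ∩ A], with no condition on images, bounds the dimension over
   [B ∩ X], and left approximations then give one with syzygies in [X]. *)
rewrite !has_resolutionP //; split=> [/(resolved_terms XM)//|rM].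
apply: resolved_pd_le => //; apply: pd_le_resolved rM => E [XE AE].
exact: pd_AX.
Qed.

Lemma pdim_resdim_omega M : pair_wedge omega X M ->
  pdim (B `&` X) M = resdim omega X M.
Proof.
have Wiso := summand_iso_closed omega_summand.
have isoX := summand_iso_closed Xsummand.
move=> [[m /(has_resolutionP isoX Wiso) rm] XM]; apply: emin_ext => n.
rewrite has_resolutionP //; split; first exact: resolved_omega_pd_le rm.
exact: pd_le_resolved pd_omega.
Qed.

End Pair.
End Dimensions.

(** * Transfer to the opposite category, where [A] and [B] exchange roles *)

Section Opposite.
Local Open Scope classical_set_scope.
Local Open Scope cat_scope.
Variable C : abelianCategory.
Local Notation Cop := (opp_abelian C).
Implicit Types X Y Z K E N M L : C.
Implicit Types D Q P W : set C.

Lemma opp_short_exact X Y Z (f : hom X Y) (g : hom Y Z) :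
  @short_exact Cop Z Y X g f <-> short_exact f g.
Proof. by rewrite !short_exactP opp_ses. Qed.

Lemma opp_summand_closed D : summand_closed D -> @summand_closed Cop D.
Proof.
move=> sD X Y S [i1 [i2 [p1 [p2 [? ? ? ? ?]]]]]; apply: (sD X Y S).
by exists p1, p2, i1, i2.
Qed.

Lemma opp_extension_closed D : extension_closed D -> @extension_closed Cop D.
Proof. by move=> eD X Y Z f g /opp_short_exact s DX DZ; apply: eD s DZ DX. Qed.

Lemma opp_left_complete D A B :
  right_complete_pair D A B -> @left_complete_pair Cop D B A.
Proof.
move=> r X /r[E [F [f [g [s BF AE]]]]]; exists F, E, g, f; split=> //.
exact/opp_short_exact.
Qed.

Lemma opp_hereditary D A B :
  hereditary_pair D A B -> @hereditary_pair Cop D B A.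
Proof.
move=> /id_class_eq0 her; apply/id_class_eq0 => Y Z k AY BZ.
by apply/Ext_eq0_opp; apply: her.
Qed.

Lemma opp_rel_generator W D : rel_cogenerator W D -> @rel_generator Cop W D.
Proof.
move=> [WD cog]; split=> // Z /cog[E [Z' [f [g [s WE DZ']]]]].
by exists E, Z', g, f; split=> //; apply/opp_short_exact.
Qed.

Lemma opp_pdim D M : @pdim Cop D M = idim D M.
Proof.
by apply: emin_ext => n; split=> H Z DZ k nk; apply/Ext_eq0_opp; apply: H.
Qed.

Lemma opp_has_resolution Q P n M : iso_closed P -> iso_closed Q ->
  @has_resolution Cop Q P n M <-> has_coresolution Q P n M.
Proof.
have opp_iso D : iso_closed D -> @iso_closed Cop D.
  by move=> isoD X Y f g gf fg; exact: (isoD X Y g f gf fg).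
move=> Piso Qiso; rewrite has_resolutionP; try exact: opp_iso.
by rewrite resolved_opp has_coresolutionP.
Qed.

Lemma opp_wedge Q P : iso_closed P -> iso_closed Q -> @wedge Cop Q P = vee Q P.
Proof.
move=> Piso Qiso; apply/seteqP.
by split=> M [n r]; exists n; apply/opp_has_resolution.
Qed.

Lemma opp_resdim Q P M : iso_closed P -> iso_closed Q ->
  @resdim Cop Q P M = coresdim Q P M.
Proof.
by move=> Piso Qiso; apply: emin_ext => n; apply: opp_has_resolution.
Qed.

End Opposite.

Local Open Scope classical_set_scope.

Theorem proposition4p23 (C : abelianCategory) (X A B : set C)
    (ABcomplete : complete_pair X A B) (ABhereditary : hereditary_pair X A B)
    (Aext : extension_closed A) (Asummand : summand_closed A)
    (Xext : extension_closed X) (Xsummand : summand_closed X)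
    (Bext : extension_closed B) (Bsummand : summand_closed B) :
  let omega := A `&` B `&` X in
  (* (a) *)
  (rel_injective (A `&` X) omega /\ rel_cogenerator omega (A `&` X)) /\
  (* (b) *)
  (rel_projective (B `&` X) omega /\ rel_generator omega (B `&` X)) /\
  (* (c) *)
  (forall M : C, pair_wedge A X M ->
    [/\ pdim (B `&` X) M = pdim omega M,
        pdim omega M = pdim (wedge omega setT) M,
        pdim (wedge omega setT) M = resdim A X M
      & resdim A X M = resdim (X `&` A) setT M]) /\
  (* (d) *)
  (forall M : C, pair_wedge omega X M ->
    pdim (B `&` X) M = resdim omega X M) /\
  (* (e) *)
  (forall M : C, pair_vee X B M ->
    [/\ idim (A `&` X) M = idim omega M,
        idim omega M = idim (vee omega setT) M,
        idim (vee omega setT) M = coresdim B X M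
      & coresdim B X M = coresdim (X `&` B) setT M]) /\
  (* (f) *)
  (forall M : C, pair_vee X omega M ->
    idim (A `&` X) M = coresdim omega X M).
Proof.
move=> omega; have [ABleft ABright] := ABcomplete.
have /id_class_eq0 her := ABhereditary.
have gen : rel_generator omega (B `&` X).
  split=> [Z [[_ BZ] XZ] // | Z [BZ XZ]].
  (* The approximation [E] is also in [B], as an extension of [Z] by [F]; hence it lies in
     [omega]. *)
  have [E [F [f [g [s [AE XE] [BF XF]]]]]] := ABleft Z XZ.
  by exists E, F, f, g; split=> //; do !split=> //; apply: Bext s BF BZ.
have cogen : rel_cogenerator omega (A `&` X).
  split=> [Z [[AZ _] XZ] // | Z [AZ XZ]].
  have [E [F [f [g [s [BF XF] [AE XE]]]]]] := ABright Z XZ.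
  by exists F, E, f, g; split=> //; do !split=> //; apply: Aext s AZ AE.
have isoX := summand_iso_closed Xsummand.
have isoB := summand_iso_closed Bsummand.
have isoXB := summand_iso_closed (summand_closedI Xsummand Bsummand).
have isoW : iso_closed omega := summand_iso_closed
  (summand_closedI (summand_closedI Asummand Bsummand) Xsummand).
(* With [A] and [B] exchanged, [omega] appears as [B ∩ A ∩ X]; [setIC] reconciles the two forms. *)
have cogen_op : @rel_generator (opp_abelian C) (B `&` A `&` X) (A `&` X).
  by rewrite (setIC B); apply: opp_rel_generator.
have ABher_op := opp_hereditary ABhereditary.
have As := opp_summand_closed Asummand.
have Xs := opp_summand_closed Xsummand.
have Bs := opp_summand_closed Bsummand.
split.
  by split=> //; apply/id_class_eq0 => Y Z k [[_ BY] XY] AZ; apply: her.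
split.
  by split=> //; apply/pd_class_eq0 => Y Z k [[AY _] XY] BZ; apply: her.
split; first by move=> M; apply: pdim_resdim.
split; first by move=> M; apply: pdim_resdim_omega.
split=> M [XM vM].
  have := @pdim_resdim (opp_abelian C) X B A (opp_left_complete ABright)
    ABher_op (opp_extension_closed Xext) Bs Xs As cogen_op M.
  rewrite /pair_wedge (setIC B) (opp_wedge isoX isoB).
  rewrite (opp_wedge (@iso_closedT C) isoW) !opp_pdim (opp_resdim _ isoX isoB).
  by rewrite (opp_resdim _ (@iso_closedT C) isoXB); apply.
have := @pdim_resdim_omega (opp_abelian C) X B A ABher_op Bs Xs As M.
rewrite /pair_wedge (setIC B) (opp_wedge isoX isoW) opp_pdim.
by rewrite (opp_resdim _ isoX isoW); apply.
Qed.
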